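(* Let $(Z_n)$ be a BPREI as in the context, fix an initial state $i$, and assume: (SD) the walk $S$ is nondegenerate and oscillating, and $\mathbf P(S_n>0)\to\varrho$ for some $\varrho\in(0,1)$; (EL) there is a probability law $\nu_i^-$ on $\mathbb N_0$ with $\|\nu_{i,k}^--\nu_i^-\|_{\mathrm{TV}}\to0$ as $k\to\infty$, and $\mathbf P_{\nu_i^-}(Z_{m_0}>0,L_{m_0}\ge0)>0$ for some $m_0\ge0$; (UIM) there is $s_0>0$ such that for every $s\in(0,s_0]$ there is a summable sequence $(\overline a_m(s))_{m\ge0}$ with $\sup_{\nu}\mathbf E_\nu[Z_m^{-s};Z_m>0,L_m\ge0]\le\overline a_m(s)$ for all $m\ge0$, the supremum being over $\nu\in\{\nu_{i,k}^-:k\ge0\}\cup\{\nu_i^-\}$; (LOC) for every $s\in(0,s_0]$, $\dfrac1{d_n^-}\sum_{k=0}^{\lfloor n/2\rfloor}d_k^-\,\overline a_{n-k}(s)\to0$ as $n\to\infty$. Let $g:\mathbb N_0\to[0,\infty)$ be bounded with $g(0)=0$, and suppose that for some $q>0$ and $C_g<\infty$, $g(k)\le C_gk^{-q}$ for every $k\ge1$. Then $$\frac{\mathbf E_i[g(Z_n)]}{d_n^-}\longrightarrow\sum_{m=0}^\infty\mathbf E_{\nu_i^-}[g(Z_m);L_m\ge0],$$ and the limit is finite and nonnegative.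
   Context: Notation: $\mathbb N_0=\{0,1,2,\dots\}$; $\mathbf E[Y;B]=\mathbf E[Y\mathbf 1_B]$; $\mathbf P_i,\mathbf P_\nu$ refer to initial state $i$, resp. initial law $\nu$. BPREI (branching process in an i.i.d. random environment with immigration). $\mathcal E_n=(Q_n,G_n)$, $n\ge0$, are i.i.d. marks, where $Q_n$ (reproduction law) and $G_n$ (immigration law) are random probability measures on $\mathbb N_0$, possibly dependent on each other. Conditional on the environment, $Z_{n+1}=\sum_{i=1}^{Z_n}\xi_{n,i}+\eta_{n+1}$, where all the variables $\xi_{n,i},\eta_{n+1}$ are independent, $\xi_{n,i}\sim Q_n$, $\eta_{n+1}\sim G_n$; $Z_0$ is independent of everything else. $M_n$ is the mean of $Q_n$, in $(0,\infty)$ a.s. Environmental walk: $S_0:=0$, $S_n:=\sum_{j=0}^{n-1}\log M_j$, $L_n:=\min_{0\le j\le n}S_j$, $\tau_n:=\min\{0\le j\le n:S_j=L_n\}$, $d_n^-:=\mathbf P(\tau_n=n)=\mathbf P(\max_{1\le j\le n}S_j<0)$. Endpoint-minimum entrance laws: $\nu_{i,k}^-(A):=\mathbf P_i(Z_k\in A\mid\tau_k=k)$, $A\subseteq\mathbb N_0$, $k\ge0$. *)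

(* Defs.v *)
From HB Require Import structures.
From mathcomp Require Import all_boot all_order all_algebra.
From mathcomp Require Import all_classical all_reals all_analysis.
From mathcomp Require Import measurable_realfun.

Set Implicit Arguments.
Unset Strict Implicit.
Unset Printing Implicit Defensive.

Import Order.TTheory GRing.Theory Num.Theory.
Import numFieldNormedType.Exports.

Local Open Scope classical_set_scope.
Local Open Scope ring_scope.

(* The normalization of the total variation norm (sup over events, or twice that)
   is immaterial for convergence to 0. *)
Definition tv_dist (R : realType) (mu nu : probability nat R) : \bar R :=
  ereal_sup [set `|mu A - nu A|%E | A in [set: set nat]].

(* P( . | A); only meaningful when P A <> 0 (otherwise it is P itself). *)
Definition cond_prob d (T : measurableType d) (R : realType)
    (P : probability T R) (A : set T) (mA : measurable A) : probability T R :=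
  mnormalize (mrestr P mA) P.

(* Taking some of the [A n] to be the full set covers all finite subfamilies. *)
Definition iid d d' (T : measurableType d) (T' : measurableType d')
    (R : realType) (P : probability T R) (X : nat -> T -> T') : Prop :=
  (forall n A, measurable A -> P (X n @^-1` A) = P (X 0%N @^-1` A)) /\
  (forall N (A : nat -> set T'), (forall n, measurable (A n)) ->
    P (\bigcap_(n in [set n | (n < N)%N]) (X n @^-1` A n)) =
    (\prod_(n < N) P (X n @^-1` A n))%E).

(* A mark is a pair (reproduction law, immigration law). *)
Notation mark R := (pprobability nat R * pprobability nat R)%type.

Definition env_sigma d (T : measurableType d) (R : realType)
    (env : nat -> T -> mark R) : set_system T :=
  <<s \bigcup_n preimage_set_system [set: T] (env n) measurable >>.

(* [bp_quenched] : given the environment, all the [xi n j] and [eta n.+1] are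
   independent, with [xi n j] of law [Q_n] and [eta n.+1] of law [G_n].
   The variable [eta 0] is not used. *)
Record bprei d (T : measurableType d) (R : realType) (P : probability T R) :=
  BPREI {
  bp_env : nat -> {mfun T >-> mark R} ;
  bp_xi : nat -> nat -> {mfun T >-> nat} ;
  bp_eta : nat -> {mfun T >-> nat} ;
  bp_env_iid : iid P bp_env ;
  bp_quenched : forall (B : set T) (N K : nat)
      (A : nat -> nat -> set nat) (D : nat -> set nat),
    env_sigma bp_env B ->
    P (B `&` \bigcap_(n in [set n | (n < N)%N])
         ((\bigcap_(j in [set j | (j < K)%N]) (bp_xi n j @^-1` A n j))
          `&` bp_eta n.+1 @^-1` D n)) =
    (\int[P]_(w in B) \prod_(n < N)
       ((\prod_(j < K) (bp_env n w).1 (A n j)) * (bp_env n w).2 (D n)))%E ;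
  bp_mean_pos_fin : forall n,
    {ae P, forall w, (0 < \int[(bp_env n w).1]_k (k%:R%:E) < +oo)%E} }.

Section BPREI.
Context d (T : measurableType d) (R : realType) (P : probability T R).
Variable X : bprei P.

Definition bp_mean (n : nat) (w : T) : \bar R :=
  (\int[(bp_env X n w).1]_k (k%:R%:E))%E.

(* [fine] is harmless: the means are finite almost surely. *)
Definition bp_logmean (n : nat) (w : T) : R := ln (fine (bp_mean n w)).

Definition bp_S (n : nat) (w : T) : R := \sum_(j < n) bp_logmean j w.

Definition bp_L (n : nat) (w : T) : R :=
  \big[Num.min/bp_S 0 w]_(j < n.+1) bp_S j w.

(* First index at which the minimum is attained. *)
Definition bp_tau (n : nat) (w : T) : nat :=
  find (fun j => bp_S j w == bp_L n w) (iota 0 n.+1).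

Definition bp_d (n : nat) : R := fine (P [set w | bp_tau n w = n]).

(* The process lives on [nat * T]; the first coordinate is the initial state. *)
Fixpoint bp_Z (n : nat) (x : nat * T) : nat :=
  if n is m.+1 then
    (\sum_(j < bp_Z m x) bp_xi X m j x.2 + bp_eta X m.+1 x.2)%N
  else x.1.

(* Under the product measure, Z_0 has law [nu] and is independent of the
   environment and of all the reproduction and immigration variables. *)
Definition bp_P (nu : probability nat R) : set (nat * T) -> \bar R :=
  (nu \x P)%E.

HB.instance Definition _ nu := Measure.copy (bp_P nu) (nu \x P)%E.

Let bp_P_setT nu : bp_P nu setT = 1%E.
Proof.
rewrite /bp_P -setXTT product_measure1E//.
apply: etrans (mule1 _).
exact: (f_equal2 mule (probability_setT nu) (probability_setT P)).
Qed.

HB.instance Definition _ nu :=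
  Measure_isProbability.Build _ _ _ (bp_P nu) (bp_P_setT nu).

Definition bp_E (nu : probability nat R) (Y : nat * T -> R)
    (B : set (nat * T)) : \bar R :=
  (\int[bp_P nu]_(x in B) (Y x)%:E)%E.

Lemma measurable_nat_fun d' (T' : measurableType d') (h : nat -> T') :
  measurable_fun setT h.
Proof. by []. Qed.

Lemma measurable_diag d' (T' : measurableType d') (f : T' -> nat)
    (g : nat -> T' -> nat) :
  measurable_fun setT f -> (forall m, measurable_fun setT (g m)) ->
  measurable_fun setT (fun x => g (f x) x).
Proof.
move=> mf mg _ A mA.
have -> : setT `&` (fun x => g (f x) x) @^-1` A =
    \bigcup_m ((setT `&` f @^-1` [set m]) `&` (setT `&` g m @^-1` A)).
  apply/seteqP; split => [x [_ Ax]|x [m _ [[_ <-] [_ Ax]]]]; last by split.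
  by exists (f x).
by apply: bigcup_measurable => m _; apply: measurableI; [apply: mf|apply: mg].
Qed.

Lemma measurable_addn d' (T' : measurableType d') (f g : T' -> nat) :
  measurable_fun setT f -> measurable_fun setT g ->
  measurable_fun setT (fun x => (f x + g x)%N).
Proof.
move=> mf mg; apply: (@measurable_diag _ _ f (fun m x => (m + g x)%N)) => // m.
exact: (measurableT_comp (@measurable_nat_fun _ _ (addn m)) mg).
Qed.

Lemma measurable_sumn d' (T' : measurableType d') (f : nat -> T' -> nat) n :
  (forall j, measurable_fun setT (f j)) ->
  measurable_fun setT (fun x => (\sum_(j < n) f j x)%N).
Proof.
move=> mf; elim: n => [|n IH].
  by under eq_fun do rewrite big_ord0; exact: measurable_cst.
by under eq_fun do rewrite big_ord_recr/=; exact: measurable_addn.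
Qed.

Lemma measurable_bp_Z n : measurable_fun [set: (nat * T)%type] (bp_Z n).
Proof.
elim: n => [|n IH] /=; first exact: measurable_fst.
apply: measurable_addn.
  apply: (@measurable_diag _ _ _
    (fun m x => (\sum_(j < m) bp_xi X n j x.2)%N)) => // m.
  apply: (@measurable_sumn _ _ (fun j x => bp_xi X n j x.2)) => j.
  by apply: measurableT_comp => //; exact: measurable_snd.
by apply: measurableT_comp => //; exact: measurable_snd.
Qed.

HB.instance Definition _ n :=
  isMeasurableFun.Build _ _ _ _ (bp_Z n) (measurable_bp_Z n).

Lemma measurable_bp_mean n : measurable_fun [set: T] (bp_mean n).
Proof.
have mQ : measurable_fun setT (fun w => (bp_env X n w).1).
  by apply: measurableT_comp => //; exact: measurable_fst.
apply: (@measurable_fun_integral_kernel _ _ _ _ _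
  (fun w => (bp_env X n w).1) _ (fun k : nat => (k%:R : R)%:E)) => //=.
by move=> U mU; exact: (measurable_kernel (kprobability mQ)).
Qed.

Lemma measurable_bp_S n : measurable_fun [set: T] (bp_S n).
Proof.
apply: measurable_sum => j.
apply: (measurableT_comp (@measurable_ln R)).
apply: (measurableT_comp (fine_measurable measurableT)).
exact: measurable_bp_mean.
Qed.

Lemma measurable_bp_L n : measurable_fun [set: T] (bp_L n).
Proof.
rewrite /bp_L; elim: (index_enum _) => [|j s IH].
  by under eq_fun do rewrite big_nil; exact: measurable_bp_S.
under eq_fun do rewrite big_cons /=.
by apply: measurable_minr => //; exact: measurable_bp_S.
Qed.

Lemma measurable_bp_tau n : measurable_fun [set: T] (bp_tau n).
Proof.
rewrite /bp_tau; elim: (iota _ _) => [|j s IH] /=; first exact: measurable_cst.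
apply: measurable_fun_ifT; last 2 first.
- exact: measurable_cst.
- exact: (measurableT_comp (@measurable_nat_fun _ _ S) IH).
by apply: measurable_fun_eqr; [exact: measurable_bp_S|exact: measurable_bp_L].
Qed.

Definition bp_minE (k : nat) : set (nat * T) := [set x | bp_tau k x.2 = k].

Lemma measurable_bp_minE k : measurable (bp_minE k).
Proof.
have mt : measurable_fun setT (fun x : nat * T => bp_tau k x.2).
  apply: measurableT_comp; first exact: measurable_bp_tau.
  exact: measurable_snd.
by have := mt measurableT [set k] I; rewrite setTI.
Qed.

(* Law of Z_k under P_i conditional on [tau_k = k]. *)
Definition bp_entrance (i k : nat) : probability nat R :=
  distribution (cond_prob (bp_P \d_i) (measurable_bp_minE k)) (bp_Z k).

End BPREI.

(* Main.v *)
Require Import Defs.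
From HB Require Import structures.
From mathcomp Require Import all_boot all_order all_algebra.
From mathcomp Require Import all_classical all_reals all_analysis.
From mathcomp Require Import measurable_realfun.
From mathcomp Require Import zify ring lra.

(** Decomposing at the time [k] of the first minimum of [S_0, ..., S_n], the
    Markov property gives
    [E_i[g(Z_n)] = \sum_(k <= n) d_k E_(nu_k)[g(Z_(n-k)); L_(n-k) >= 0]].
    Since [g(z) <= Cg z^(-s)] with [s = min(q, s0)], the [m]-th expectation is
    at most [Cg abar_m(s)]; the terms with [k <= n/2] are then negligible by
    (LOC), and in the others, indexed by [m = n - k], dominated convergence
    applies once [d_(n-m) / d_n -> 1] and [d_(n-m) <= 4 d_n] for [m < n/2].

    Instead of regular variation of [d], both facts follow from the Sparre
    Andersen recursion [n d_n = \sum_(1 <= k <= n) P(S_k < 0) d_(n-k)]: as [d] is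
    nonincreasing and [P(S_k < 0) -> 1 - rho], it yields
    [n d_n ~ (1 - rho) \sum_(j < n) d_j]. The convergence of [P(S_k < 0)] is
    (SD) together with [P(S_k = 0) -> 0], which holds for nondegenerate steps.
    The recursion is the renewal equation for strict descending ladder epochs
    combined with [P(S_n < 0) = E[sigma; n is a ladder epoch]], where [sigma] is
    the first ladder epoch, an identity obtained by rotating the steps.

    Independence is used only in this form: on the space of sequences of
    generations (mark, offspring numbers, immigrants), the law of the process is
    the image of its own square under the splicing of the first [k] letters of
    one sequence with another sequence. *)

Set Implicit Arguments.
Unset Strict Implicit.
Unset Printing Implicit Defensive.

Import Order.TTheory GRing.Theory Num.Theory.
Import numFieldNormedType.Exports.

Local Open Scope classical_set_scope.
Local Open Scope ring_scope.

(** * Renewal-type recursions and ratio limits *)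

Section renewal_ratio.
Context (R : realType) (u p : nat -> R) (c : R).
Hypotheses (u0 : u 0%N = 1) (u_ge0 : forall n, 0 <= u n)
  (u_noninc : forall n, u n.+1 <= u n)
  (p_ge0 : forall n, 0 <= p n) (p_le1 : forall n, p n <= 1).
Hypothesis rec : forall n, n%:R * u n = \sum_(1 <= k < n.+1) p k * u (n - k)%N.
Hypotheses (p_cvg : p @ \oo --> c) (c_gt0 : 0 < c).

Lemma renewal_le m n : (m <= n)%N -> u n <= u m.
Proof.
move=> /subnK <-; elim: (n - m)%N => [|k IH] //.
exact: le_trans (u_noninc _) IH.
Qed.

(** A zero of [u] persists by monotonicity, and then the recursion, whose terms are all nonnegative,
    forces [p k * u 0 = 0]; so [p] would vanish eventually, against [c > 0]. *)
Lemma renewal_gt0 n : 0 < u n.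
Proof.
rewrite lt_neqAle u_ge0 andbT eq_sym; apply/negP => /eqP un0.
have p0 k : (n <= k)%N -> (0 < k)%N -> p k = 0.
  move=> nk k0; have uk0 : u k = 0.
    by apply/eqP; rewrite eq_le u_ge0 andbT -un0 renewal_le.
  have := rec k; rewrite uk0 mulr0 => /esym/eqP.
  rewrite psumr_eq0; last by move=> i _; rewrite mulr_ge0.
  move=> /allP/(_ k); rewrite mem_index_iota k0 ltnSn => /(_ isT).
  by rewrite subnn u0 mulr1 /= => /eqP.
have : p @ \oo --> (0 : R).
  apply/cvgrPdist_le => e e0; near=> k.
  rewrite p0 ?subrr ?normr0 ?ltW//; near: k.
    exact: nbhs_infty_ge.
  exact: nbhs_infty_gt.
move=> /(cvg_unique _ p_cvg) /= /(_ (@norm_hausdorff _ _)) c0.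
by move: c_gt0; rewrite c0 ltxx.
Unshelve. all: by end_near. Qed.

Let D n := \sum_(0 <= j < n) u j.

Let D_rev n : D n = \sum_(1 <= k < n.+1) u (n - k)%N.
Proof.
rewrite /D big_nat_rev/= big_add1/=; apply: eq_bigr => i _.
by rewrite add0n.
Qed.

Let D_gt0 n : (0 < n)%N -> 0 < D n.
Proof.
case: n => // n _; rewrite /D big_nat_recr//= ltr_wpDl ?renewal_gt0//.
by apply: sumr_ge0.
Qed.

Let D_ge k n : (k <= n)%N -> (n - k).+1%:R * u (n - k)%N <= D n.+1.
Proof.
move=> kn; rewrite /D (big_cat_nat (n := (n - k).+1))//=; last first.
  by rewrite ltnS leq_subr.
rewrite ler_wpDr//; first by apply: sumr_ge0.
rewrite -[X in X%:R](subn0) mulrC mulr_natr -sumr_const_nat.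
by apply: ler_sum_nat => i /andP[_ ik]; exact: renewal_le.
Qed.

(** By the recursion the difference is the sum of [(p k - c) * u (n - k)]. The terms with [k >= K]
    have a factor at most [e / 2] and add up to at most [e / 2 * D n]; the finitely many others are
    of order [u (n - K)], which is at most [D n / (n - K)]. *)
Lemma renewal_partial_sum e : 0 < e ->
  \forall n \near \oo, `|n%:R * u n - c * D n| <= e * D n.
Proof.
move=> e0; have e20 : 0 < e / 2 by rewrite divr_gt0.
have := p_cvg; move=> /cvgrPdist_le /(_ _ e20) [K _ pK].
near=> n.
have Kn : (K < n)%N by near: n; exact: nbhs_infty_gt.
have n0 : (0 < n)%N by exact: leq_ltn_trans Kn.
rewrite rec D_rev !mulr_sumr -sumrB.
apply: (le_trans (ler_norm_sum _ _ _)).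
(* The indicator marks the first terms, where only [|p k - c| <= 1 + c] is available. *)
apply: (@le_trans _ _ (\sum_(1 <= k < n.+1)
    (e / 2 * u (n - k)%N + (k < K)%:R * ((1 + c) * u (n - K)%N)))).
  apply: ler_sum_nat => k /andP[k1 kn].
  rewrite -mulrBl normrM (ger0_norm (u_ge0 _)).
  case: ltnP => kK; last first.
    by rewrite mul0r addr0 ler_wpM2r// distrC pK.
  rewrite mul1r; apply: ler_wpDl; first by rewrite mulr_ge0// ltW.
  apply: ler_pM => //; last by rewrite renewal_le// leq_sub2l// ltnW.
  rewrite (le_trans (ler_normB _ _))// lerD//; first by rewrite ger0_norm.
  by rewrite gtr0_norm.
rewrite big_split/= -mulr_sumr -D_rev -mulr_suml -mulr_sumr -D_rev.
have -> : e * D n = e / 2 * D n + e / 2 * D n by rewrite -mulrDl -splitr.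
rewrite lerD2l.
have sK : \sum_(1 <= k < n.+1) (k < K)%:R <= K%:R :> R.
  rewrite -natr_sum ler_nat.
  apply: (@leq_trans (\sum_(0 <= k < n.+1) (k < K))%N).
    by rewrite [leqRHS]big_nat_recl//= big_add1 leq_addl.
  rewrite (big_cat_nat (n := K))//=; last exact: leqW (ltnW Kn).
  rewrite [X in (_ + X)%N]big_nat [X in (_ + X)%N]big1 ?addn0; last first.
    by move=> k /andP[Kk _]; rewrite ltnNge Kk.
  apply: (@leq_trans (\sum_(0 <= k < K) 1)%N).
    by apply: leq_sum => k _; exact: leq_b1.
  by rewrite sum_nat_const_nat muln1 subn0.
apply: (@le_trans _ _ (K%:R * ((1 + c) * u (n - K)%N))).
  by rewrite ler_wpM2r// mulr_ge0// addr_ge0// ltW.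
have uD : (n - K)%:R * u (n - K)%N <= D n.
  have := @D_ge K n.-1; rewrite prednK// -ltnS prednK// => /(_ Kn).
  have -> : (n.-1 - K).+1 = (n - K)%N by rewrite -subSn ?prednK// -ltnS prednK.
  apply: le_trans; apply: ler_wpM2l; first exact: ler0n.
  by apply: renewal_le; rewrite leq_sub2r// leq_pred.
have nK0 : 0 < (n - K)%:R :> R by rewrite ltr0n subn_gt0.
rewrite -(ler_pM2l nK0).
apply: (@le_trans _ _ (K%:R * (1 + c) * D n)).
  rewrite mulrCA -mulrA ler_wpM2l// mulrCA ler_wpM2l//.
  by rewrite addr_ge0// ltW.
rewrite mulrA ler_wpM2r//; first by rewrite ltW// D_gt0.
rewrite natrB ?(ltnW Kn)// -ler_pdivrMr// lerBrDr.
near: n; exact: nbhs_infty_ger.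
Unshelve. all: by end_near. Qed.

(** Up to a factor close to 1, [n * u n] is [c * D n], and [D] is nondecreasing. The tolerance [t]
    is the solution of [c + t = (1 + e) * (c - t)]. *)
Lemma renewal_quasi_decreasing e : 0 < e -> exists N, forall k n,
  (N <= k <= n)%N -> k%:R * u k <= (1 + e) * (n%:R * u n).
Proof.
move=> e0; pose t := c * e / (2 + e).
have e2 : 0 < 2 + e by rewrite addr_gt0.
have t0 : 0 < t by rewrite /t !mulr_gt0// invr_gt0.
have [N _ HN] := renewal_partial_sum t0.
exists N => k n /andP[Nk kn].
have := HN k Nk; rewrite /= ler_distl => /andP[_ Hk].
have := HN n (leq_trans Nk kn); rewrite /= ler_distl => /andP[Hn _].
have DD : D k <= D n.
  by rewrite /D [leRHS](big_cat_nat (n := k))//= lerDl; apply: sumr_ge0.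
apply: (le_trans Hk); rewrite -mulrDl.
apply: (@le_trans _ _ ((c + t) * D n)).
  by rewrite ler_wpM2l// addr_ge0// ltW.
have -> : c + t = (1 + e) * (c - t).
  by rewrite /t; field; rewrite gt_eqF.
rewrite -mulrA ler_wpM2l//; first by rewrite addr_ge0// ltW.
by rewrite mulrBl.
Qed.

(** One factor 2 comes from quasi-monotonicity with [e = 1], the other from [n <= 2 k]. *)
Lemma renewal_dominated : exists N, forall k n,
  (N <= k <= n)%N -> (n <= k.*2)%N -> u k <= 4 * u n.
Proof.
have [N HN] := renewal_quasi_decreasing ltr01.
exists (maxn N 1) => k n /andP[]; rewrite geq_max => /andP[Nk k0] kn n2k.
have := HN k n; rewrite Nk kn => /(_ isT) H.
have kR : 0 < k%:R :> R by rewrite ltr0n.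
rewrite -(ler_pM2l kR); apply: (le_trans H).
rewrite mulrA mulrA ler_wpM2r// (_ : _ * 4 = (1 + 1) * (k.*2)%:R :> R).
  by rewrite ler_wpM2l ?ler_nat//; lra.
by rewrite -muln2 natrM; lra.
Qed.

(** The ratio is at least 1 by monotonicity and at most [(1 + t) * n / (n - m)] by
    quasi-monotonicity. *)
Lemma renewal_ratio_cvg m : u (n - m)%N / u n @[n --> \oo] --> (1 : R).
Proof.
apply/cvgrPdist_le => e e0.
(* With [t <= 1] and [t <= e / 3], one gets [(1 + t) ^ 2 <= 1 + 3 t <= 1 + e]; the second factor
   [1 + t] absorbs [n / (n - m)]. *)
have t0 : 0 < Num.min 1 (e / 3) by rewrite lt_min ltr01 divr_gt0.
set t := Num.min _ _ in t0.
have t1 : t <= 1 by rewrite ge_min lexx.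
have t3 : t <= e / 3 by rewrite ge_min lexx orbT.
have [N HN] := renewal_quasi_decreasing t0.
near=> n.
have nm : (m < n)%N by near: n; exact: nbhs_infty_gt.
have un := renewal_gt0 n.
rewrite distrC ler_distl; apply/andP; split.
  apply: (@le_trans _ _ 1); first by rewrite gerBl ltW.
  by rewrite ler_pdivlMr// mul1r renewal_le// leq_subr.
have := HN (n - m)%N n; rewrite leq_subr andbT => H.
have /H{}H : (N <= n - m)%N.
  by rewrite leq_subRL ?(ltnW nm)//; near: n; exact: nbhs_infty_ge.
rewrite ler_pdivrMr//.
have nmR : 0 < (n - m)%:R :> R by rewrite ltr0n subn_gt0.
rewrite -(ler_pM2l nmR); apply: (le_trans H).
rewrite mulrA mulrA ler_wpM2r//.
apply: (@le_trans _ _ ((1 + t) * ((1 + t) * (n - m)%:R))); last first.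
  rewrite mulrA mulrC ler_wpM2l// ?(ltW nmR)//.
  have : t * t <= t by rewrite ler_piMr// ltW.
  nra.
rewrite ler_wpM2l//; first by rewrite addr_ge0// ltW.
rewrite natrB ?(ltnW nm)//.
have : (1 + t) * m%:R / t <= n%:R by near: n; exact: nbhs_infty_ger.
rewrite ler_pdivrMr//; nra.
Unshelve. all: by end_near. Qed.

End renewal_ratio.

(** * Convolution of sequences and the derivative of the renewal equation *)

Section convolution_renewal.
Context (R : nzRingType).
Implicit Types a b c : nat -> R.

Definition conv a b n := \sum_(j < n.+1) a j * b (n - j)%N.

Let coef_conv a b N n : (n <= N)%N ->
  ((\poly_(i < N.+1) a i) * (\poly_(i < N.+1) b i))`_n = conv a b n.
Proof.
move=> nN; rewrite coefM; apply: eq_bigr => j _; rewrite !coef_poly.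
rewrite (leq_trans (ltn_ord j))// ifT//.
by rewrite ltnS (leq_trans (leq_subr _ _)).
Qed.

(** Coefficients of order at most [n] of a product only see coefficients of order at most [n] of the
    factors, so associativity is inherited from truncated polynomials. *)
Lemma convA a b c n : conv a (conv b c) n = conv (conv a b) c n.
Proof.
pose tr (x : nat -> R) := \poly_(i < n.+1) x i.
transitivity ((tr a * (tr b * tr c))`_n).
  rewrite coefM; apply: eq_bigr => j _.
  by rewrite coef_poly ltn_ord coef_conv// leq_subr.
rewrite mulrA coefM; apply: eq_bigr => j _.
rewrite coef_conv -1?ltnS// coef_poly ifT//.
by rewrite ltnS leq_subr.
Qed.

Lemma eq_conv a a' b b' : a =1 a' -> b =1 b' -> conv a b =1 conv a' b'.
Proof. by move=> aa bb n; apply: eq_bigr => j _; rewrite aa bb. Qed.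

Lemma conv_sum1 a b n : a 0%N = 0 ->
  conv a b n = \sum_(1 <= k < n.+1) a k * b (n - k)%N.
Proof.
move=> a0; rewrite /conv -(big_mkord xpredT (fun j => a j * b (n - j)%N)).
by rewrite big_nat_recl// a0 mul0r add0r big_add1.
Qed.

End convolution_renewal.

Section convolution_derivation.
Context (R : comNzRingType).
Variables (u f p : nat -> R).
Hypotheses (u0 : u 0%N = 1) (f0 : f 0%N = 0) (p0 : p 0%N = 0).
Hypothesis uE : forall n, (0 < n)%N ->
  u n = \sum_(1 <= k < n.+1) f k * u (n - k)%N.
Hypothesis pE : forall n,
  p n = \sum_(1 <= k < n.+1) k%:R * f k * u (n - k)%N.

(* With generating functions, [U = 1 + F U] and [P = t F' U] give [t U' = P U]. *)
Lemma renewal_derivation n :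
  n%:R * u n = \sum_(1 <= k < n.+1) p k * u (n - k)%N.
Proof.
rewrite -conv_sum1//; pose h k := k%:R * f k.
have pE' : p =1 conv h u by move=> k; rewrite pE conv_sum1// /h f0 mulr0.
have uE' k : u k = (k == 0%N)%:R + conv f u k.
  case: k => [|k]; first by rewrite /conv big_ord1 f0 mul0r addr0 u0.
  by rewrite add0r uE// conv_sum1.
(* The Leibniz rule for [U = 1 + F U]: split the weight as [k = j + (k - j)]. *)
have dE k : k%:R * u k = p k + conv f (fun j => j%:R * u j) k.
  rewrite {1}uE' mulrDr pE' /conv mulr_sumr -big_split/=.
  rewrite (_ : _ * (k == 0%N)%:R = 0) ?add0r; last first.
    by case: k => [|k]; rewrite ?mul0r// mulr0.
  apply: eq_bigr => j _; rewrite /h.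
  have -> : k%:R = j%:R + (k - j)%:R :> R.
    by rewrite -natrD subnKC// -ltnS.
  by rewrite !mulrDl mulrA mulrCA.
have pu k : conv p u k = p k + conv f (conv p u) k.
  have -> : conv f (conv p u) k = conv p (conv f u) k.
    rewrite !convA; apply: eq_conv => // {}k; rewrite /conv.
    rewrite (reindex_inj rev_ord_inj)/=; apply: eq_bigr => j _.
    by rewrite mulrC subSS subKn// -ltnS.
  rewrite {1}/conv; under eq_bigr do rewrite uE' mulrDr.
  rewrite big_split/=; congr (_ + _).
  rewrite big_ord_recr/= subnn mulr1 big1 ?add0r// => j _.
  by rewrite subn_eq0 leqNgt ltn_ord mulr0.
(* Both sides solve [x = p + conv f x]. As [f 0 = 0], this equation expresses [x n] through earlier
   values, so its solution is unique. *)
elim/ltn_ind: n => n IH; rewrite dE pu; congr (_ + _).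
apply: eq_bigr => -[[|j] jn] _ /=; first by rewrite f0 !mul0r.
have j_lt_n : (j < n)%N by [].
by rewrite IH// ltn_subrL (leq_ltn_trans _ j_lt_n).
Qed.

End convolution_derivation.

(** * Series, integrals over the integers, and total variation *)

Lemma summableZl (R : realType) (c : R) (a : nat -> R) : 0 <= c ->
  summable [set: nat] (EFin \o a) -> summable [set: nat] (fun m => (c * a m)%:E).
Proof.
move=> c0 sa; rewrite /summable (eq_esum (b := fun m => c%:E * `|(a m)%:E|)%E); last first.
  by move=> m _ /=; rewrite normrM ger0_norm.
rewrite -nneseries_esumT; last by move=> m; rewrite mule_ge0.
rewrite nneseriesZl; last by move=> m _.
rewrite nneseries_esumT; last by move=> m.
by apply: lte_mul_pinfty => //; rewrite ?lee_fin//; exact: sa.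
Qed.

Lemma tannery (R : realType) (b : nat -> nat -> R) (e M : nat -> R) :
  (forall n m, 0 <= b n m <= M m) ->
  (forall m, b n m @[n --> \oo] --> e m) ->
  summable [set: nat] (EFin \o M) ->
  (\sum_(0 <= m <oo) (b n m)%:E)%E @[n --> \oo] -->
    (\sum_(0 <= m <oo) (e m)%:E)%E.
Proof.
move=> bM be sM.
have e0 m : 0 <= e m.
  apply: (@closed_cvg _ _ _ eventually_filter (b^~ m) (fun x => 0 <= x)).
  - exact: closed_ge.
  - by apply: nearW => n; have /andP[] := bM n m.
  - exact: be.
have E (a : nat -> R) : (forall m, 0 <= a m) ->
    (\sum_(0 <= m <oo) (a m)%:E = \int[@counting nat R]_m (a m)%:E)%E.
  by move=> a0; rewrite ge0_integral_count// => k; rewrite lee_fin.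
have [] // := @dominated_convergence _ nat R (@counting nat R) setT measurableT
  (fun n m => (b n m)%:E) (fun m => (e m)%:E) (EFin \o M).
- apply: aeW => m _; apply: cvg_EFin; last exact: be.
  exact: nearW.
- apply/integrableP; split => //.
  rewrite ge0_integral_count// nneseries_esum//.
  by move: sM; rewrite /summable; congr (_ < _)%E; congr esum; apply/seteqP.
- apply: aeW => m n _ /=; have /andP[b0 bm] := bM n m.
  by rewrite lee_fin ger0_norm.
- move=> _ _; rewrite E//; apply: cvg_trans; apply: near_eq_cvg; apply: nearW.
  by move=> n; rewrite E// => m; have /andP[] := bM n m.
Qed.

Lemma ge0_integral_nat (R : realType) (mu : {measure set nat -> \bar R})
    (f : nat -> \bar R) : (forall k, 0 <= f k)%E ->
  (\int[mu]_k f k = \sum_(0 <= k <oo) f k * mu [set k])%E.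
Proof.
move=> f0; have -> : [set: nat] = \bigcup_k [set k].
  by apply/seteqP; split => // k _; exists k.
rewrite ge0_integral_bigcup//=; last first.
  by move=> i j _ _ [k [-> ->]].
apply: eq_eseriesr => k _.
rewrite (eq_integral (cst (f k))); first by rewrite integral_cst.
by move=> x /[!inE] ->.
Qed.

(** The one-sided bound on events is tested on the set where [mu] charges points at least as much as
    [nu], as in the Hahn decomposition. *)
Lemma tv_integral_le (R : realType) (mu nu : probability nat R) (h : nat -> R)
    (B t : R) : (forall k, 0 <= h k <= B) ->
  (forall A, mu A <= nu A + t%:E)%E ->
  (\int[mu]_k (h k)%:E <= \int[nu]_k (h k)%:E + (B * t)%:E)%E.
Proof.
move=> hB tv.
have h0 k : 0 <= h k by have /andP[] := hB k.
have B0 : 0 <= B by have /andP[] := hB 0%N; exact: le_trans.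
pose a (m : probability nat R) k := fine (m [set k]).
have aE (m : probability nat R) k : m [set k] = (a m k)%:E.
  by rewrite fineK// fin_num_measure.
have E (m : probability nat R) :
    (\int[m]_k (h k)%:E = \sum_(0 <= k <oo) (h k * a m k)%:E)%E.
  rewrite ge0_integral_nat; last by move=> k; rewrite lee_fin.
  by apply: eq_eseriesr => k _; rewrite EFinM -aE.
have a0 m k : 0 <= a m k by exact: fine_ge0.
rewrite [leLHS]E; apply: lime_le.
  by apply: is_cvg_nneseries => k _ _; rewrite lee_fin mulr_ge0.
apply: nearW => N.
apply: (@le_trans _ _ (\sum_(0 <= k < N) (h k * a nu k)%:E + (B * t)%:E)%E); last first.
  rewrite leeD2r// E; apply: nneseries_lim_ge => k _ _.
  by rewrite lee_fin mulr_ge0.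
rewrite !sumEFin -EFinD lee_fin -lerBlDl -sumrB.
pose S := \big[setU/set0]_(k < N | a nu k <= a mu k) [set (k : nat)].
have mS (m : probability nat R) :
    m S = (\sum_(k < N | a nu k <= a mu k) a m k)%:E.
  rewrite /S (@measure_bigsetU_ord_cond _ _ _ m N _ (fun k => [set (k : nat)]))//.
    by rewrite -sumEFin; apply: eq_bigr => k _; rewrite -aE.
  by move=> i j _ _ [k [ik jk]]; apply: val_inj; move: ik jk => /= <- <-.
have := tv S; rewrite !mS -EFinD lee_fin -lerBlDl -sumrB => H.
apply: (@le_trans _ _ (B * \sum_(k < N | a nu k <= a mu k) (a mu k - a nu k))).
  rewrite big_mkord mulr_sumr [leRHS]big_mkcond/=; apply: ler_sum => k _.
  rewrite -mulrBr; case: ifPn => [ab|]; last first.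
    by rewrite -ltNge => /ltW ab; rewrite mulr_ge0_le0// subr_le0.
  by rewrite ler_wpM2r ?subr_ge0//; have /andP[] := hB k.
exact: ler_wpM2l.
Qed.

Lemma tv_integral_cvg (R : realType) (mu : nat -> probability nat R)
    (nu : probability nat R) (h : nat -> R) (B : R) :
  (forall k, 0 <= h k <= B) -> tv_dist (mu k) nu @[k --> \oo] --> 0%E ->
  fine (\int[mu k]_z (h z)%:E)%E @[k --> \oo] --> fine (\int[nu]_z (h z)%:E)%E.
Proof.
move=> hB tv0.
have h0 k : 0 <= h k by have /andP[] := hB k.
have B0 : 0 <= B by have /andP[] := hB 0%N; exact: le_trans.
have hfin (m : probability nat R) : (\int[m]_z (h z)%:E)%E \is a fin_num.
  rewrite ge0_fin_numE; last by apply: integral_ge0 => z _; rewrite lee_fin.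
  apply: (@le_lt_trans _ _ B%:E); last exact: ltry.
  rewrite -[leRHS]mule1 -(probability_setT m) -integral_cst//.
  apply: ge0_le_integral => // z _; rewrite lee_fin//.
  by have /andP[] := hB z.
apply/cvgrPdist_le => e e0.
(* The shift to [B + 1] keeps the divisor positive when [B = 0]. *)
have t0 : 0 < e / (B + 1) by rewrite divr_gt0// ltr_wpDl.
have : \forall k \near \oo, (tv_dist (mu k) nu < (e / (B + 1))%:E)%E.
  have t0' : (0 < (e / (B + 1))%:E)%E by rewrite lte_fin.
  exact: tv0 _ (open_ereal_lt' t0').
apply: filterS => k tvk.
have tvA A : (`|mu k A - nu A| <= (e / (B + 1))%:E)%E.
  by apply: le_trans (ltW tvk); apply: ereal_sup_ubound; exists A.
have Bt : B * (e / (B + 1)) <= e.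
  by rewrite mulrA ler_pdivrMr ?ltr_wpDl// mulrC ler_wpM2l ?lerDl// ltW.
have fin A (m : probability nat R) : m A = (fine (m A))%:E.
  by rewrite fineK// fin_num_measure.
have le1 := @tv_integral_le R (mu k) nu h B (e / (B + 1)) hB.
have le2 := @tv_integral_le R nu (mu k) h B (e / (B + 1)) hB.
rewrite ler_distl; apply/andP; split.
- rewrite lerBlDr -lee_fin EFinD !fineK//; apply: (le_trans (le1 _)).
    move=> A; have := tvA A; rewrite (fin A (mu k)) (fin A nu) -EFinB lee_fin.
    by rewrite ler_distl -EFinD lee_fin => /andP[_].
  by rewrite leeD2l// lee_fin.
- rewrite -lee_fin EFinD !fineK//; apply: (le_trans (le2 _)).
    move=> A; have := tvA A; rewrite (fin A (mu k)) (fin A nu) -EFinB lee_fin.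
    by rewrite ler_distl -EFinD lee_fin lerBlDr => /andP[].
  by rewrite leeD2l// lee_fin.
Qed.

(** * Limit of a convolution normalised by the renewal sequence *)

Section renewal_convolution_limit.
Context (R : realType) (d : nat -> R) (e : nat -> nat -> R) (e' M : nat -> R).
Hypothesis d_gt0 : forall n, 0 < d n.
Hypothesis d_dominated : exists N, forall k n,
  (N <= k <= n)%N -> (n <= k.*2)%N -> d k <= 4 * d n.
Hypothesis d_ratio : forall m, d (n - m)%N / d n @[n --> \oo] --> (1 : R).
Hypothesis e_bound : forall k m, 0 <= e k m <= M m.
Hypothesis e_cvg : forall m, e k m @[k --> \oo] --> e' m.
Hypothesis M_summable : summable [set: nat] (EFin \o M).
Hypothesis M_loc :
  (d n)^-1 * (\sum_(0 <= k < n./2.+1) d k * M (n - k)%N) @[n --> \oo] --> 0.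

(** The terms with [k > n./2], indexed by [m = n - k] and extended by 0, so that the upper half of
    the sum becomes a series in [m] open to dominated convergence. *)
Let b n m := if (m < n - n./2)%N then d (n - m)%N / d n * e (n - m)%N m else 0.

Let conv_split n : (\sum_(0 <= k < n.+1) d k * e k (n - k)%N) / d n =
  (d n)^-1 * (\sum_(0 <= k < n./2.+1) d k * e k (n - k)%N) +
  \sum_(0 <= m < n - n./2) b n m.
Proof.
rewrite (big_cat_nat (n := n./2.+1))//= ?ltnS ?half_leqn//; last first.
  by rewrite -divn2 leq_div.
rewrite mulrDl mulrC; congr (_ + _).
rewrite -[X in (\sum_(X <= _ < _) _) / _](add0n n./2.+1) big_addn subSS big_nat_rev/= mulr_suml.
apply: eq_big_nat => m /andP[_ mn].
have nn : (n./2 <= n)%N by rewrite -divn2 leq_div.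
have -> : (0 + (n - n./2) - m.+1 + n./2.+1 = n - m)%N by lia.
have -> : (n - (n - m) = m)%N by lia.
by rewrite /b mn mulrAC.
Qed.

Let b_ge0 n m : 0 <= b n m.
Proof.
rewrite /b; case: ifP => // _; rewrite mulr_ge0//.
  by rewrite divr_ge0// ltW.
by have /andP[] := e_bound (n - m) m.
Qed.

Let b_series n :
  (\sum_(0 <= m <oo) (b n m)%:E = (\sum_(0 <= m < n - n./2) b n m)%:E)%E.
Proof.
rewrite -sumEFin; apply: cvg_lim => //; apply: cvg_near_cst; near=> K.
rewrite (big_cat_nat (n := n - n./2))//=; last by near: K; exact: nbhs_infty_ge.
rewrite [X in (_ + X)%E]big1_seq ?adde0// => m /=; rewrite mem_index_iota => /andP[nm _].
by rewrite /b ltnNge nm.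
Unshelve. all: by end_near. Qed.

Let b_cvg m : b n m @[n --> \oo] --> e' m.
Proof.
have H : d (n - m)%N / d n * e (n - m)%N m @[n --> \oo] --> e' m.
  rewrite -[e' m]mul1r; apply: cvgM; first exact: d_ratio.
  exact: (cvg_comp (fun n => n - m)%N (e^~ m) (@cvg_subnr m) (@e_cvg m)).
apply: cvg_trans H; apply: near_eq_cvg; near=> n.
rewrite /b ifT//.
have : (m.*2.+2 <= n)%N by near: n; exact: nbhs_infty_ge.
lia.
Unshelve. all: by end_near. Qed.

Lemma renewal_convolution_cvg :
  ((\sum_(0 <= k < n.+1) d k * e k (n - k)%N) / d n)%:E @[n --> \oo] -->
  (\sum_(0 <= m <oo) (e' m)%:E)%E.
Proof.
have [N dN] := d_dominated.
have Hb : (\sum_(0 <= m <oo) (b n m)%:E)%E @[n --> \oo] -->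
    (\sum_(0 <= m <oo) (e' m)%:E)%E.
  (* After this shift, [m < n - n./2] implies [n - m >= N] and [n <= 2 (n - m)], so the factor 4 of
     [d_dominated] holds for every [n] and not just eventually. *)
  rewrite -(cvg_shiftn N.*2)/=.
  apply: (@tannery R (fun n m => b (n + N.*2)%N m) e' (fun m => 4 * M m)).
  - move=> n m; rewrite b_ge0/=; set n' := (n + _)%N; rewrite /b.
    have /andP[e0 eM] := e_bound (n' - m) m.
    case: ifP => mn; last by rewrite mulr_ge0// (le_trans _ eM).
    apply: ler_pM => //; first by rewrite divr_ge0// ltW.
    by rewrite ler_pdivrMr// dN//; lia.
  - by move=> m; apply: (cvg_comp (fun n => n + N.*2)%N (b^~ m) _ (b_cvg (m := m)));
      exact: cvg_addnr.
  - exact: summableZl.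
(* The early block lies between 0 and the quantity controlled by [M_loc]. *)
have Ha : ((d n)^-1 * (\sum_(0 <= k < n./2.+1) d k * e k (n - k)%N))%:E
    @[n --> \oo] --> 0%E.
  apply: cvg_EFin; first exact: nearW.
  apply: (@squeeze_cvgr _ _ _ _ (cst 0)); last 2 first.
  - exact: cvg_cst.
  - exact: M_loc.
  apply: nearW => n; apply/andP; split.
    rewrite mulr_ge0 ?invr_ge0 ?(ltW (d_gt0 _))//; apply: sumr_ge0 => k _.
    by rewrite mulr_ge0 ?(ltW (d_gt0 _))//; have /andP[] := e_bound k (n - k).
  rewrite ler_wpM2l ?invr_ge0 ?(ltW (d_gt0 _))//; apply: ler_sum => k _.
  by rewrite ler_wpM2l ?(ltW (d_gt0 _))//; have /andP[] := e_bound k (n - k).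
rewrite -[X in _ --> X]add0e.
under eq_fun do rewrite conv_split EFinD -b_series.
exact: cvgeD.
Qed.

Lemma renewal_convolution_lty : (0 <= \sum_(0 <= m <oo) (e' m)%:E < +oo)%E.
Proof.
have e'_bound m : 0 <= e' m <= M m.
  apply/andP; split.
    apply: (@closed_cvg _ _ _ eventually_filter (e^~ m) (fun x => 0 <= x)).
    - exact: closed_ge.
    - by apply: nearW => n; have /andP[] := e_bound n m.
    - exact: e_cvg.
  apply: (@closed_cvg _ _ _ eventually_filter (e^~ m) (fun x => x <= M m)).
  - exact: closed_le.
  - by apply: nearW => n; have /andP[] := e_bound n m.
  - exact: e_cvg.
apply/andP; split.
  by apply: nneseries_ge0 => m _ _; rewrite lee_fin; have /andP[] := e'_bound m.
apply: le_lt_trans M_summable; rewrite -nneseries_esumT//.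
apply: lee_nneseries => m _.
  by rewrite lee_fin; have /andP[] := e'_bound m.
have /andP[e0 eM] := e'_bound m.
by rewrite lee_fin (le_trans eM)// ler_norm.
Qed.

End renewal_convolution_limit.

(** * Sequence spaces and splicing *)

Lemma emeasurable_prod d (S : measurableType d) (R : realType) N
    (h : nat -> S -> \bar R) : (forall n, measurable_fun setT (h n)) ->
  measurable_fun setT (fun x => \prod_(n < N) h n x)%E.
Proof.
move=> mh; elim: N => [|N IH].
  by under eq_fun do rewrite big_ord0; exact: measurable_cst.
by under eq_fun do rewrite big_ord_recr/=; exact: emeasurable_funM.
Qed.

Section sequence_space.
Context (T : pointedType) (G : set_system T).

Definition cylinder (N : nat) (A : nat -> set T) : set (nat -> T) :=
  [set w | forall n, (n < N)%N -> A n (w n)].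

Definition cylinders : set_system (nat -> T) :=
  [set C | exists N (A : nat -> set T), (forall n, G (A n)) /\ C = cylinder N A].

(** Letters carry only a class [G] of sets; when [G] is closed under intersection and contains the
    whole space, cylinders are a pi-system that determines probabilities. *)
Definition seqspace := g_sigma_algebraType cylinders.
HB.instance Definition _ := Measurable.on seqspace.

Definition splice (k : nat) (w : seqspace * seqspace) : seqspace :=
  fun n => if (n < k)%N then w.1 n else w.2 (n - k)%N.

Lemma splice_lt k n w : (n < k)%N -> splice k w n = w.1 n.
Proof. by move=> nk; rewrite /splice nk. Qed.

Lemma spliceD k n w : splice k w (k + n)%N = w.2 n.
Proof. by rewrite /splice ltnNge leq_addr/= addnC addnK. Qed.

Lemma measurable_cylinder N A : (forall n, G (A n)) ->
  measurable (cylinder N A : set seqspace).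
Proof. by move=> GA; apply: sub_sigma_algebra; exists N, A. Qed.

Hypotheses (GI : setI_closed G) (GT : G setT).

Lemma measurable_coord_gen n B : G B -> measurable [set w : seqspace | B (w n)].
Proof.
move=> GB; pose A m := if m == n then B else setT.
rewrite (_ : mkset _ = cylinder n.+1 A); last first.
  apply/seteqP; split => [w Bw m _|w /(_ n (ltnSn n))]; last by rewrite /A eqxx.
  by rewrite /A; case: eqP => // ->.
by apply: measurable_cylinder => m; rewrite /A; case: ifP.
Qed.

Lemma measurable_coord d (V : measurableType d) (H : set_system V) (f : T -> V) n :
  @measurable _ V = <<s H>> -> (forall B, H B -> G (f @^-1` B)) ->
  measurable_fun [set: seqspace] (fun w : seqspace => f (w n)).
Proof.
move=> VH HG; apply: (measurability H) => // _ [B HB <-]; rewrite setTI.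
exact: (measurable_coord_gen (B := f @^-1` B) n (HG _ HB)).
Qed.

Lemma measurable_to_seqspace d (S : measurableType d) (W : S -> seqspace) :
  (forall n B, G B -> measurable [set s | B (W s n)]) ->
  measurable_fun setT W.
Proof.
move=> mW; apply: (measurability (cylinders : set (set seqspace))) => // _ [_ [N [A [GA ->]]] <-].
rewrite setTI (_ : _ @^-1` _ = \bigcap_(n in `I_N) [set s | A n (W s n)]) //.
apply: fin_bigcap_measurable => // n _; exact: mW.
Qed.

Lemma cylinders_setI : setI_closed cylinders.
Proof.
move=> _ _ [N [A [GA ->]]] [M [B [GB ->]]].
pose C n := (if (n < N)%N then A n else setT) `&` (if (n < M)%N then B n else setT).
exists (maxn N M), C; split.
  by move=> n; apply: GI; case: ifP.
apply/seteqP; split => [w [wA wB] n _|w wC].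
  by split; case: ifPn => // ?; [exact: wA|exact: wB].
split=> n nN.
  have nNM : (n < maxn N M)%N by rewrite leq_max nN.
  by have [+ _] := wC n nNM; rewrite nN.
have nNM : (n < maxn N M)%N by rewrite leq_max nN orbT.
by have [_ +] := wC n nNM; rewrite nN.
Qed.

Lemma preimage_splice k N A : splice k @^-1` cylinder N A =
  (cylinder (minn N k) A : set seqspace) `*`
  (cylinder (N - k) (fun n => A (k + n)%N) : set seqspace).
Proof.
apply/seteqP; split => [w wA|w [w1 w2] n nN].
  split => n /=.
    rewrite leq_min => /andP[nN nk]; rewrite -(splice_lt w nk); exact: wA.
  by rewrite ltn_subRL => nN; rewrite -(spliceD k); exact: wA.
case: (ltnP n k) => nk; first by rewrite splice_lt//; apply: w1; rewrite leq_min nN.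
by rewrite -(subnKC nk) spliceD; apply: w2; rewrite ltn_sub2r// (leq_ltn_trans nk).
Qed.

Lemma measurable_splice k : measurable_fun setT (splice k).
Proof.
apply: (measurability (cylinders : set (set seqspace))) => // _ [_ [N [A [GA ->]]] <-].
rewrite setTI preimage_splice.
by apply: measurableX; apply: measurable_cylinder.
Qed.

Context (R : realType).
Local Open Scope ereal_scope.

Lemma seqspace_measure_unique (mu nu : probability seqspace R) :
  (forall N A, (forall n, G (A n)) -> mu (cylinder N A) = nu (cylinder N A)) ->
  forall E, measurable E -> mu E = nu E.
Proof.
move=> H E mE.
apply: (@measure_unique _ R seqspace cylinders (fun=> setT)) => //.
- exact: cylinders_setI.
- move=> _; exists 0%N, (fun=> setT); split => //.
  by apply/seteqP; split.
- by rewrite bigcup_const//; exists 0%N.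
- by move=> _ [N [A [GA ->]]]; exact: H.
- by move=> _; rewrite ltey_eq fin_num_measure.
Qed.

(** The Markov property at fixed times, for independent letters: the tail after [k] letters is
    independent of them and again has law [mu]. *)
Definition splice_invariant (mu : probability seqspace R) :=
  forall k E, measurable E -> mu E = (mu \x mu) (splice k @^-1` E).

(** The preimage of a cylinder under splicing is a product of two cylinders, and the product of the
    [r (A n)] splits at [k] accordingly; uniqueness on the pi-system of cylinders extends this to
    all events. *)
Lemma iid_splice_invariant (mu : probability seqspace R) (r : set T -> \bar R) :
  (forall N A, (forall n, G (A n)) -> mu (cylinder N A) = \prod_(n < N) r (A n)) ->
  splice_invariant mu.
Proof.
move=> muE k E mE.
have mS : measurable_fun setT (splice k) by exact: measurable_splice.
pose S : {mfun _ >-> _} := HB.pack (splice k) (isMeasurableFun.Build _ _ _ _ _ mS).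
suff : mu E = distribution (mu \x mu) S E by [].
apply: seqspace_measure_unique => // N A GA.
transitivity ((mu \x mu) (splice k @^-1` cylinder N A)); last by [].
rewrite preimage_splice product_measure1E; last 2 first.
- exact: measurable_cylinder.
- exact: measurable_cylinder.
transitivity ((\prod_(n < minn N k) r (A n)) * \prod_(n < N - k) r (A (k + n)%N));
  last by congr (_ * _); apply/esym/muE.
rewrite muE//; case: (leqP N k) => Nk.
  have /eqP -> : (N - k == 0)%N by rewrite subn_eq0.
  by rewrite big_ord0 mule1.
rewrite -!(big_mkord xpredT (fun n => r (A n))) (big_cat_nat (n := k))//=; last exact: ltnW.
congr (_ * _); rewrite -{1}(add0n k) big_addn big_mkord.
by apply: eq_bigr => i _; rewrite addnC.
Qed.

Section splice_integral.
Variables (mu : probability seqspace R) (mu_splice : splice_invariant mu).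

Lemma splice_integral k (f : seqspace -> \bar R) : measurable_fun setT f ->
  (forall w, 0 <= f w) ->
  \int[mu]_w f w = \int[mu]_a \int[mu]_b f (splice k (a, b)).
Proof.
move=> mf f0; have mS : measurable_fun setT (splice k) by exact: measurable_splice.
pose S : {mfun _ >-> _} := HB.pack (splice k) (isMeasurableFun.Build _ _ _ _ _ mS).
rewrite (eq_measure_integral (distribution (mu \x mu) S)); last first.
  by move=> A mA _; rewrite [LHS](mu_splice k).
rewrite ge0_integral_distribution//.
rewrite (@fubini_tonelli1 _ _ _ _ _ mu mu (f \o S))//.
  exact: measurableT_comp.
by move=> w; exact: f0.
Qed.

Lemma splice_measure k (E : set seqspace) : measurable E ->
  mu E = \int[mu]_a mu [set b | E (splice k (a, b))].
Proof.
move=> mE; rewrite (mu_splice k)// /product_measure1.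
apply: eq_integral => a _ /=; congr (mu _).
by apply/seteqP; split => b; rewrite /xsection/= inE.
Qed.

(** Splicing at 1 peels off the first letter; the remaining factors are handled by induction for the
    shifted family [f n.+1]. *)
Lemma splice_integral_prod N (f : nat -> T -> \bar R) :
  (forall m n, measurable_fun setT (fun w : seqspace => f m (w n))) ->
  (forall m t, 0 <= f m t) ->
  \int[mu]_w \prod_(n < N) f n (w n) = \prod_(n < N) \int[mu]_w f n (w 0%N).
Proof.
elim: N f => [|N IH] f mf f0.
  rewrite big_ord0; under eq_integral do rewrite big_ord0.
  by rewrite integral_cst// mul1e; exact: probability_setT.
have prod_ge0 M (g : nat -> \bar R) : (forall n, 0 <= g n) -> 0 <= \prod_(n < M) g n.
  by move=> g0; apply: prode_ge0 => n _.
rewrite (splice_integral 1)//; last 2 first.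
- exact: (@emeasurable_prod _ seqspace _ N.+1 (fun n w => f n (w n))).
- by move=> w; apply: (prod_ge0 N.+1 (fun n => f n (w n))) => n.
under eq_integral.
  move=> a _; under eq_integral.
    move=> b _; rewrite big_ord_recl/= splice_lt//=.
    under eq_bigr do rewrite /bump/= spliceD/=.
    over.
  rewrite ge0_integralZl//; last 2 first.
  - exact: (@emeasurable_prod _ seqspace _ N (fun n w => f n.+1 (w n))).
  - by move=> w _; apply: (prod_ge0 N (fun n => f n.+1 (w n))).
  rewrite (IH (fun n => f n.+1))//.
  over.
rewrite ge0_integralZr//; last first.
  apply: (prod_ge0 N (fun n => \int[mu]_w f n.+1 (w 0%N))) => n.
  by apply: integral_ge0.
by rewrite big_ord_recl.
Qed.

End splice_integral.
End sequence_space.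

(** * Ladder epochs of a random walk *)

Section measurable_sets.
Context d (S : measurableType d) (R : realType).
Implicit Types f g : S -> R.

Lemma measurable_lt_set f g : measurable_fun setT f -> measurable_fun setT g ->
  measurable [set w | f w < g w].
Proof.
move=> mf mg; have := measurable_fun_ltr mf mg measurableT (Y := [set true]) I.
by rewrite setTI.
Qed.

Lemma measurable_le_set f g : measurable_fun setT f -> measurable_fun setT g ->
  measurable [set w | f w <= g w].
Proof.
move=> mf mg; have := measurable_fun_ler mf mg measurableT (Y := [set true]) I.
by rewrite setTI.
Qed.

Lemma measurable_eq_set f y : measurable_fun setT f ->
  measurable [set w | f w = y].
Proof.
move=> mf; have := mf measurableT [set y] (measurable_set1 y).
by rewrite setTI.
Qed.

Lemma measurable_forall_lt n (A : nat -> set S) :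
  (forall j, measurable (A j)) -> measurable [set w | forall j, (j < n)%N -> A j w].
Proof.
move=> mA; rewrite (_ : mkset _ = \bigcap_(j in `I_n) A j)//.
by apply: fin_bigcap_measurable => // j _; exact: mA.
Qed.

Lemma prob_partition (mu : probability S R) n (E : set S) (B : nat -> set S) :
  (forall k, measurable (B k)) ->
  (forall j k w, B j w -> B k w -> j = k) ->
  (forall w, E w <-> exists2 k, (k < n)%N & B k w) ->
  fine (mu E) = \sum_(k < n) fine (mu (B k)).
Proof.
move=> mB tB EB; have -> : E = \big[setU/set0]_(k < n) B k.
  by apply/seteqP; split => w; rewrite -bigcup_mkord; [move/EB|move=> ?; apply/EB].
rewrite (@measure_bigsetU _ _ _ mu)//; last first.
  by move=> j k _ _ [w [jw kw]]; exact: (tB j k w).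
by rewrite sum_fine// => k _; rewrite fin_num_measure.
Qed.

Lemma product_measure_swap (mu : probability S R) (E : set (S * S)) :
  measurable E -> (mu \x mu)%E E = (mu \x mu)%E ((fun w => (w.2, w.1)) @^-1` E).
Proof.
move=> mE; pose swap (w : S * S) := (w.2, w.1).
have mswap : measurable_fun setT swap by exact: measurable_fun_pair.
pose s : {mfun _ >-> _} := HB.pack swap (isMeasurableFun.Build _ _ _ _ _ mswap).
transitivity (distribution (mu \x mu)%E s E); last by [].
apply: product_measure_unique => // A B mA mB.
transitivity ((mu \x mu)%E (B `*` A)).
  rewrite /= /distribution /pushforward; congr ((mu \x mu)%E _).
  by apply/seteqP; split => -[a b] [].
by rewrite product_measure1E// muleC.
Qed.

End measurable_sets.

Section walk.
Context (T : pointedType) (G : set_system T) (R : realType).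
Hypotheses (GI : setI_closed G) (GT : G setT).
Variables (mu : probability (seqspace G) R) (step : T -> R).
Hypothesis mu_splice : splice_invariant mu.
Hypothesis mstep : forall n,
  measurable_fun setT (fun w : seqspace G => step (w n)).

Definition walk (n : nat) (w : seqspace G) : R := \sum_(j < n) step (w j).

Lemma walk0 w : walk 0 w = 0. Proof. exact: big_ord0. Qed.

Lemma walk1 w : walk 1 w = step (w 0%N). Proof. exact: big_ord1. Qed.

Lemma walk_splice_le j k w : (j <= k)%N -> walk j (splice k w) = walk j w.1.
Proof.
move=> jk; apply: eq_bigr => i _.
by rewrite splice_lt// (leq_trans (ltn_ord i) jk).
Qed.

Lemma walk_spliceD k j w :
  walk (k + j) (splice k w) = walk k w.1 + walk j w.2.
Proof.
rewrite /walk big_split_ord/=; congr (_ + _); apply: eq_bigr => i _.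
  by rewrite splice_lt.
by rewrite spliceD.
Qed.

Lemma measurable_walk n : measurable_fun setT (walk n).
Proof. by apply: measurable_sum => j; exact: mstep. Qed.

Local Notation Pr E := (fine (mu E)).

Lemma prod_prob (A B : set (seqspace G)) : measurable A -> measurable B ->
  fine ((mu \x mu)%E (A `*` B)) = Pr A * Pr B.
Proof.
by move=> mA mB; rewrite product_measure1E// fineM// fin_num_measure.
Qed.

Definition ladder n : set (seqspace G) :=
  [set w | forall j, (j < n)%N -> walk n w < walk j w].

(** The first passage below 0 is the first strict descending ladder epoch after time 0, so this is
    the event [sigma = n]. *)
Definition first_descent n : set (seqspace G) :=
  [set w | (forall j, (j < n)%N -> 0 <= walk j w)] `&` [set w | walk n w < 0].

Lemma measurable_ladder n : measurable (ladder n).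
Proof.
apply: (@measurable_forall_lt _ _ _ (fun j => [set w | walk n w < walk j w])) => j.
by apply: measurable_lt_set; exact: measurable_walk.
Qed.

Lemma measurable_first_descent n : measurable (first_descent n).
Proof.
apply: measurableI.
  apply: (@measurable_forall_lt _ _ _ (fun j => [set w | 0 <= walk j w])) => j.
  by apply: measurable_le_set => //; exact: measurable_walk.
by apply: measurable_lt_set => //; exact: measurable_walk.
Qed.

Lemma ladder0 : Pr (ladder 0) = 1.
Proof.
by rewrite (_ : ladder 0 = setT) ?probability_setT//; apply/seteqP; split.
Qed.

(** If [n + 1] is a ladder epoch, then [n] is one for the path deprived of its first step. *)
Lemma ladder_noninc n : Pr (ladder n.+1) <= Pr (ladder n).
Proof.
rewrite fine_le ?fin_num_measure//; try exact: measurable_ladder.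
rewrite (mu_splice 1); last exact: measurable_ladder.
rewrite -[leRHS]mul1e -(probability_setT mu) -product_measure1E//; last first.
  exact: measurable_ladder.
apply: le_measure; rewrite ?inE.
- rewrite -[X in measurable X]setTI.
  by apply: (measurable_splice 1) => //; exact: measurable_ladder.
- by apply: measurableX => //; exact: measurable_ladder.
- move=> w Lw; split => // j jn.
  have := Lw j.+1; rewrite ltnS => /(_ jn).
  by rewrite -(add1n n) -(add1n j) !walk_spliceD ltrD2l.
Qed.

(** Splicing at [k] turns the event into a product set. Times before [k] put no constraint on the
    tail, because the path is nonnegative there while [S_n <= S_k < 0]. *)
Lemma first_descent_ladder k n : (k <= n)%N ->
  Pr (first_descent k `&` ladder n) = Pr (first_descent k) * Pr (ladder (n - k)).
Proof.
move=> kn; rewrite (mu_splice k); last first.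
  by apply: measurableI; [exact: measurable_first_descent|exact: measurable_ladder].
rewrite -prod_prob; [|exact: measurable_first_descent|exact: measurable_ladder].
congr (fine ((mu \x mu)%E _)); apply/seteqP; split => [w [[w1 w2] w3]|w [[w1 w2] w3]].
  split; [split => [j jk|]|move=> j jk].
  - by have := w1 j jk; rewrite walk_splice_le// ltnW.
  - by move: w2; rewrite /= walk_splice_le.
  - have := w3 (k + j)%N; rewrite -ltn_subRL => /(_ jk).
    by rewrite -[X in walk X _ < _](subnKC kn) !walk_spliceD ltrD2l.
split; [split => [j jk|]|move=> j jn].
- by rewrite walk_splice_le ?w1// ltnW.
- by rewrite /= walk_splice_le.
rewrite -[X in walk X _ < _](subnKC kn) walk_spliceD.
case: (ltnP j k) => jk; last first.
  by rewrite -(subnKC jk) walk_spliceD ltrD2l w3// ltn_sub2r// (leq_ltn_trans jk).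
rewrite walk_splice_le ?(ltnW jk)//; apply: (@lt_le_trans _ _ 0); last exact: w1.
move: w2 => /= w2; case: (posnP (n - k)%N) => [->|nk]; first by rewrite walk0 addr0.
have := w3 0%N nk; rewrite walk0 => w3'; lra.
Qed.

Lemma first_descent_uniq j k w : first_descent j w -> first_descent k w -> j = k.
Proof.
move=> [j1 j2] [k1 k2]; case: (ltngtP j k) => // H.
- by have := k1 _ H; rewrite leNgt (_ : _ < _).
- by have := j1 _ H; rewrite leNgt (_ : _ < _).
Qed.

Lemma first_descent0 : first_descent 0 = set0.
Proof. by apply/seteqP; split => // w [_] /=; rewrite walk0 ltxx. Qed.

Lemma first_descent_ex n w : walk n w < 0 ->
  exists2 k, (k < n.+1)%N & first_descent k w.
Proof.
move=> wn; have ex : exists k, walk k w < 0 by exists n.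
case: (ex_minnP ex) => k wk kmin; exists k; first by rewrite ltnS kmin.
by split => // j jk; rewrite leNgt; apply/negP => /kmin; rewrite leqNgt jk.
Qed.

Lemma ladder_renewal n : (0 < n)%N -> Pr (ladder n) =
  \sum_(1 <= k < n.+1) Pr (first_descent k) * Pr (ladder (n - k)).
Proof.
move=> n0; rewrite (@prob_partition _ _ _ mu n.+1 _
   (fun k => first_descent k `&` ladder n)).
- rewrite -(big_mkord xpredT (fun k => fine (mu (first_descent k `&` ladder n)))).
  rewrite big_nat_recl// first_descent0 set0I measure0/= add0r big_add1/=.
  by apply: eq_big_nat => k /andP[_ kn]; rewrite first_descent_ladder.
- by move=> k; apply: measurableI;
    [exact: measurable_first_descent|exact: measurable_ladder].
- by move=> j k w [jw _] [kw _]; exact: first_descent_uniq jw kw.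
- move=> w; split => [Lw|[k _ []]//].
  have [|k kn fk] := @first_descent_ex n w; last by exists k.
  by have := Lw 0%N n0; rewrite walk0.
Qed.

(** The event that [n] is a ladder epoch and [sigma > k]; summing its probability over [k < n] gives
    the expectation of [sigma] on [ladder n]. *)
Definition late_ladder n k : set (seqspace G) :=
  ladder n `&` [set w | forall j, (j < k.+1)%N -> 0 <= walk j w].

(** On [S_n < 0], the first minimiser among the times [1, ..., n] is [n - k]: strict inequalities
    before it and weak ones after it. Time 0 does not compete. *)
Definition early_argmin n k : set (seqspace G) :=
  [set w | walk n w < 0] `&`
  ([set w | forall j, (j < n - k)%N -> (0 < j)%N -> walk (n - k) w < walk j w] `&`
   [set w | forall j, (j < n.+1)%N -> (n - k < j)%N -> walk (n - k) w <= walk j w]).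

Lemma measurable_late_ladder n k : measurable (late_ladder n k).
Proof.
apply: measurableI; first exact: measurable_ladder.
apply: (@measurable_forall_lt _ _ _ (fun j => [set w | 0 <= walk j w])) => j.
by apply: measurable_le_set => //; exact: measurable_walk.
Qed.

Lemma measurable_early_argmin n k : measurable (early_argmin n k).
Proof.
apply: measurableI; first by apply: measurable_lt_set => //; exact: measurable_walk.
apply: measurableI.
  apply: (@measurable_forall_lt _ _ _ (fun j =>
    [set w | (0 < j)%N -> walk (n - k) w < walk j w])) => -[|j].
    by rewrite (_ : mkset _ = setT)//; apply/seteqP; split.
  rewrite (_ : mkset _ = [set w | walk (n - k) w < walk j.+1 w]); last first.
    by apply/seteqP; split => [w /(_ isT)|w + _].
  by apply: measurable_lt_set; exact: measurable_walk.
apply: (@measurable_forall_lt _ _ _ (fun j =>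
  [set w | (n - k < j)%N -> walk (n - k) w <= walk j w])) => j.
case: (ltnP (n - k) j) => nkj; last first.
  by rewrite (_ : mkset _ = setT)//; apply/seteqP; split.
rewrite (_ : mkset _ = [set w | walk (n - k) w <= walk j w]); last first.
  by apply/seteqP; split => [w /(_ isT)|w + _].
by apply: measurable_le_set; exact: measurable_walk.
Qed.

(* Exchanging the first [n - k] and the last [k] steps turns one event into the
   other. *)
Lemma late_ladder_rotate n k : (k < n)%N ->
  Pr (early_argmin n k) = Pr (late_ladder n k).
Proof.
move=> kn; have [m m0 ->] : exists2 m, (0 < m)%N & n = (m + k)%N.
  by exists (n - k)%N; rewrite ?subn_gt0// subnK// ltnW.
rewrite (mu_splice m); last exact: measurable_early_argmin.
rewrite (mu_splice k); last exact: measurable_late_ladder.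
(* After the swap, [b] is the block of [k] steps in both events: it comes last on the left and first
   on the right. *)
rewrite [in RHS]product_measure_swap; last first.
  rewrite -[X in measurable X]setTI.
  by apply: (measurable_splice k) => //; exact: measurable_late_ladder.
congr (fine ((mu \x mu)%E _)).
apply/seteqP; split => -[a b]; rewrite /early_argmin/late_ladder/ladder addnK.
  move=> [/=]; rewrite walk_spliceD/= => w0 [w1 w2].
  have b0 j : (j < k.+1)%N -> 0 <= walk j b.
    case: j => [|j] jk; first by rewrite walk0.
    have := w2 (m + j.+1)%N; rewrite walk_spliceD/= walk_splice_le//=.
    rewrite lerDl; apply; last by rewrite -addSnnS leq_addr.
    by rewrite ltnS leq_add2l.
  have a0 j : (j < m)%N -> walk m a + walk k b < walk k b + walk j a.
    case: j => [|j] jk; first by rewrite walk0 addr0 (lt_le_trans w0)// b0.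
    have := w1 j.+1 jk isT; rewrite !walk_splice_le ?(ltnW jk)//= => H.
    by rewrite addrC ltrD2l.
  split => [j jn|j jk] /=; last by rewrite walk_splice_le ?b0.
  rewrite [in X in X < _]addnC walk_spliceD/= addrC.
  case: (ltnP j k.+1) => jk.
    by rewrite walk_splice_le// (lt_le_trans w0)// b0.
  have -> : j = (k + (j - k))%N by rewrite subnKC// ltnW.
  by rewrite walk_spliceD/= a0// ltn_subLR ?(ltnW jk)// addnC.
move=> [] /= w1 w2.
have b0 j : (j < k.+1)%N -> 0 <= walk j b.
  by move=> jk; have := w2 j jk; rewrite walk_splice_le.
have a0 j : (j < m)%N -> walk m a < walk j a.
  move=> jm; have := w1 (k + j)%N; rewrite addnC ltn_add2r => /(_ jm).
  by rewrite [in X in X < _]addnC (addnC j) !walk_spliceD/= ltrD2l.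
split; last split => j /= jn.
- have := w1 0%N (ltn_addr _ m0).
  by rewrite /= walk0 [in X in X < 0 -> _]addnC !walk_spliceD/= addrC.
- by move=> j0; rewrite !walk_splice_le ?(ltnW jn)//=; exact: a0.
- move=> mj; have -> : j = (m + (j - m))%N by rewrite subnKC// ltnW.
  rewrite walk_spliceD/= walk_splice_le//= lerDl b0//.
  by rewrite ltnS leq_subLR -ltnS.
Qed.


Lemma early_argmin_partition n : (0 < n)%N ->
  Pr [set w | walk n w < 0] = \sum_(k < n) Pr (early_argmin n k).
Proof.
move=> n0; pose B k := if (k < n)%N then early_argmin n k else set0.
rewrite (@prob_partition _ _ _ mu n _ B).
- by apply: eq_bigr => k _; rewrite /B ltn_ord.
- by move=> k; rewrite /B; case: ifP => // _; exact: measurable_early_argmin.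
- have lt w j k : (j < k)%N -> B j w -> B k w -> False.
    rewrite /B => jk; case: ifP => // jn [_ [j1 _]]; case: ifP => // kn [_ [_ k2]].
    have kj : (n - k < n - j)%N by rewrite ltn_sub2l.
    have := k2 (n - j)%N; rewrite ltnS leq_subr => /(_ isT kj).
    by rewrite leNgt j1// subn_gt0.
  by move=> j k w jw kw; case: (ltngtP j k) => // [jk|kj];
    [case: (lt w j k)|case: (lt w k j)].
- move=> w; split => [wn|[k kn]]; last by rewrite /B kn => -[].
  (* The index shift [j.+1] excludes time 0, so the least minimiser [m] is positive and [k = n - m]
     is below [n]. *)
  pose good m := [forall j : 'I_n, walk m w <= walk j.+1 w].
  have ex : exists m, (0 < m <= n)%N && good m.
    case: n n0 @B @good wn => // n _ B good wn.
    pose i := [arg min_(i < ord0 : 'I_n.+1) walk i.+1 w]%O.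
    exists i.+1; rewrite /= ltn_ord/=; apply/forallP => j.
    by rewrite /i; case: arg_minP => // k _ ->.
  case: (ex_minnP ex) => m /andP[/andP[m0 mn] /forallP gm] mmin.
  have gm' j : (0 < j <= n)%N -> walk m w <= walk j w.
    by case: j => // j /andP[_ jn]; exact: (gm (Ordinal jn)).
  exists (n - m)%N; first by rewrite ltn_subrL m0.
  rewrite /B ltn_subrL m0 n0/= /early_argmin subKn//; split => //; split => j.
    move=> jm j0; rewrite ltNge; apply/negP => jw.
    have : (m <= j)%N.
      apply: mmin; rewrite j0 (ltnW (leq_trans jm mn))/=; apply/forallP => i.
      exact: le_trans jw (gm i).
    by rewrite leqNgt jm.
  by rewrite ltnS => jn mj; apply: gm'; rewrite jn (leq_ltn_trans _ mj).
Qed.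

Lemma late_ladder_partition n k : (k < n)%N ->
  Pr (late_ladder n k) =
  \sum_(j < n.+1) (k < j)%:R * (Pr (first_descent j) * Pr (ladder (n - j))).
Proof.
move=> kn; have n0 := leq_ltn_trans (leq0n _) kn.
pose B j := if (k < j <= n)%N then first_descent j `&` ladder n else set0.
have fk w j : first_descent j w -> (forall i, (i < k.+1)%N -> 0 <= walk i w) ->
    (k < j)%N.
  by move=> [_ /= wj] wk; rewrite ltnNge; apply/negP => /wk; rewrite leNgt wj.
rewrite (@prob_partition _ _ _ mu n.+1 _ B).
- apply: eq_bigr => j _; rewrite /B -(ltnS j) ltn_ord andbT; case: ifP => kj.
    by rewrite mul1r first_descent_ladder// -ltnS.
  by rewrite mul0r measure0.
- move=> j; rewrite /B; case: ifP => // _.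
  by apply: measurableI; [exact: measurable_first_descent|exact: measurable_ladder].
- move=> i j w; rewrite /B; case: ifP => // _ [iw _]; case: ifP => // _ [jw _].
  exact: first_descent_uniq iw jw.
- move=> w; split => [[Lw wk]|[j jn]].
    have [|j jn fj] := @first_descent_ex n w; first by have := Lw 0%N n0; rewrite walk0.
    by exists j => //; rewrite /B (fk w j)//= -ltnS jn.
  rewrite /B; case: ifP => // /andP[kj _] [[wj _] Lw]; split => // i ik.
  by apply: wj; exact: leq_trans ik kj.
Qed.

(** The tail-sum formula: adding up the events [sigma > k] over [k < n] counts each value [j <= n]
    of [sigma] exactly [j] times. *)
Lemma negative_prob n : Pr [set w | walk n w < 0] =
  \sum_(1 <= k < n.+1) k%:R * Pr (first_descent k) * Pr (ladder (n - k)).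
Proof.
case: (posnP n) => [->|n0].
  rewrite big_geq// (_ : mkset _ = set0) ?measure0//.
  by apply/seteqP; split => // w /=; rewrite walk0 ltxx.
rewrite early_argmin_partition//.
under eq_bigr do rewrite late_ladder_rotate// late_ladder_partition//.
rewrite exchange_big/= big_add1/= -(big_mkord xpredT (fun j =>
  \sum_(k < n) (k < j)%:R * (Pr (first_descent j) * Pr (ladder (n - j))))).
rewrite big_nat_recl// big1 ?add0r; last by move=> k _; rewrite mul0r.
apply: eq_big_nat => j /andP[_ jn]; rewrite -mulr_suml mulrA; congr (_ * _ * _).
rewrite -natr_sum -(big_mkord xpredT (fun k => (k < j.+1)%N : nat)).
rewrite (big_cat_nat (n := j.+1))//= big_nat (eq_bigr (fun=> 1%N)); last first.
  by move=> k /andP[_ ->].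
rewrite -big_nat sum_nat_const_nat muln1 subn0 big_nat big1 ?addn0// => k /andP[jk _].
by rewrite ltnNge jk.
Qed.

Lemma ladder_recursion n : n%:R * Pr (ladder n) =
  \sum_(1 <= k < n.+1) Pr [set w | walk k w < 0] * Pr (ladder (n - k)).
Proof.
apply: (@renewal_derivation _ (fun k => Pr (ladder k))
  (fun k => Pr (first_descent k)) (fun k => Pr [set w | walk k w < 0])).
- exact: ladder0.
- by rewrite first_descent0 measure0.
- by rewrite negative_prob big_geq.
- exact: ladder_renewal.
- exact: negative_prob.
Qed.

End walk.

(** * Concentration *)

Section concentration.
Context (T : pointedType) (G : set_system T) (R : realType).
Hypotheses (GI : setI_closed G) (GT : G setT).
Variables (mu : probability (seqspace G) R) (step : T -> R).
Hypothesis mu_splice : splice_invariant mu.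
Hypothesis mstep : forall n,
  measurable_fun setT (fun w : seqspace G => step (w n)).
Hypothesis step_nondegenerate : forall c,
  fine (mu [set w | step (w 0%N) = c]) < 1.

Local Notation walk := (walk step).
Local Notation at_ n y := (fine (mu [set w | walk n w = y])).

Let mwalk n : measurable_fun setT (walk n : seqspace G -> R).
Proof. exact: measurable_walk. Qed.

Let mat n y : measurable [set w : seqspace G | walk n w = y].
Proof. exact: measurable_eq_set. Qed.

Let atE n y : mu [set w | walk n w = y] = (at_ n y)%:E.
Proof. by rewrite fineK// fin_num_measure. Qed.

Let at_ge0 n y : 0 <= at_ n y.
Proof. exact: fine_ge0. Qed.

Lemma walk_atD m n y : (at_ (m + n) y)%:E = (\int[mu]_a (at_ n (y - walk m a))%:E)%E.
Proof.
rewrite -atE (splice_measure mu_splice m)//; apply: eq_integral => a _.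
rewrite -atE; congr (mu _); apply/seteqP; split => b /=.
  by rewrite walk_spliceD/= => <-; rewrite addrAC subrr add0r.
by rewrite walk_spliceD/= => ->; rewrite addrC subrK.
Qed.

Let mat_shift m n y :
  measurable_fun setT (fun a : seqspace G => (at_ n (y - walk m a))%:E : \bar R).
Proof.
pose E := [set w : seqspace G * seqspace G | walk n w.2 = y - walk m w.1].
have mE : measurable E.
  rewrite (_ : E = [set w | walk n w.2 + walk m w.1 = y]).
    apply: measurable_eq_set; apply: measurable_funD.
      exact: measurableT_comp (mwalk n) measurable_snd.
    exact: measurableT_comp (mwalk m) measurable_fst.
  by apply/seteqP; split => w; rewrite /E/=; [move=> ->|move=> <-];
    rewrite ?subrK ?addrK.
rewrite (_ : (fun a => _) = mu \o xsection E).
  exact: measurable_fun_xsection.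
apply/funext => a /=; rewrite -atE; congr (mu _).
by apply/seteqP; split => b; rewrite /xsection/= inE.
Qed.

Lemma walk_at_mono m n c : (forall y, at_ n y <= c) -> forall y, at_ (m + n) y <= c.
Proof.
move=> Hc y; rewrite -lee_fin walk_atD.
rewrite -[leRHS]mule1 -(probability_setT mu) -integral_cst//.
apply: ge0_le_integral => //.
- by move=> a _; rewrite lee_fin.
- by move=> a _; rewrite lee_fin Hc.
Qed.

(** Condition on [S_m]: where [S_m = z] the remaining probability is exactly [at_ n (y - z)], and
    elsewhere it is at most [c]. *)
Lemma walk_at_gain m n c y z : (forall y, at_ n y <= c) ->
  at_ (m + n) y <= c - at_ m z * (c - at_ n (y - z)).
Proof.
move=> Hc; pose Z := [set w : seqspace G | walk m w = z].
have c0 : 0 <= c by exact: le_trans (Hc 0).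
have mZ : measurable Z by exact: mat.
have mCZ : measurable (~` Z) by exact: measurableC.
have mI (r : R) (A : set (seqspace G)) : measurable A ->
    measurable_fun setT (fun a => (r%:E * (\1_A a)%:E)%E).
  move=> mA; apply: measurable_funeM; apply/measurable_EFinP.
  exact: measurable_indic.
rewrite -lee_fin walk_atD.
apply: (@le_trans _ _ (\int[mu]_a (c%:E * (\1_(~` Z) a)%:E +
    (at_ n (y - z))%:E * (\1_Z a)%:E))%E).
  apply: ge0_le_integral => //.
  - by move=> a _; rewrite lee_fin.
  - by apply: emeasurable_funD; exact: mI.
  - move=> a _; rewrite -!EFinM -EFinD lee_fin !indicE in_setC.
    case: (boolP (a \in Z)) => [/set_mem /= <-|_] /=; last by rewrite mulr1 mulr0 addr0.
    by rewrite mulr0 mulr1 add0r.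
rewrite ge0_integralD//; last 4 first.
- by move=> a _; rewrite -EFinM lee_fin mulr_ge0.
- exact: mI.
- by move=> a _; rewrite -EFinM lee_fin mulr_ge0.
- exact: mI.
rewrite !ge0_integralZl//; last 3 first.
- exact/measurable_EFinP/measurable_indic.
- by rewrite lee_fin.
- exact/measurable_EFinP/measurable_indic.
rewrite !integral_indic// !setIT.
have CZ : mu (~` Z) = (1 - at_ m z)%:E by rewrite probability_setC// atE.
apply: (@le_trans _ _ (c%:E * mu (~` Z) + (at_ n (y - z))%:E * mu Z)%E) => //.
rewrite CZ atE -!EFinM -EFinD lee_fin; lra.
Qed.

Lemma walk_atD_gt0 m n x y : 0 < at_ m x -> 0 < at_ n y -> 0 < at_ (m + n) (x + y).
Proof.
move=> mx ny; apply: (@lt_le_trans _ _ (at_ m x * at_ n y)); first exact: mulr_gt0.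
rewrite -lee_fin EFinM -!atE [leRHS](mu_splice m)// -product_measure1E//.
apply: le_measure; rewrite ?inE.
- exact: measurableX.
- by rewrite -[X in measurable X]setTI; apply: (measurable_splice m).
- by move=> w [/= w1 w2]; rewrite walk_spliceD w1 w2.
Qed.

Lemma walk_at_natmul a m : 0 < at_ 1 a -> 0 < at_ m (m%:R * a).
Proof.
move=> a0; elim: m => [|m IH].
  rewrite mul0r (_ : mkset _ = setT) ?probability_setT//.
  by apply/seteqP; split => // w _; exact: walk0.
by rewrite -addn1 natrD mulrDl mul1r; exact: walk_atD_gt0.
Qed.

Lemma sum_walk_at n m (z : nat -> R) : injective z ->
  \sum_(j < m) at_ n (z j) <= 1.
Proof.
move=> zI; pose B j := [set w : seqspace G | walk n w = z j].
pose U := [set w | exists2 j, (j < m)%N & B j w].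
have mU : measurable U.
  by apply: bigcup_measurable => j _; exact: mat.
rewrite -(@prob_partition _ _ _ mu m U B)//.
- by rewrite -lee_fin fineK ?fin_num_measure// probability_le1.
- by move=> j; exact: mat.
- by move=> j k w jw kw; apply: zI; rewrite -jw -kw.
Qed.

(* The [m + 1] points [z j] are atoms of [S_m], and [P(S_n = y - z j)] sums to at
   most 1 over [j]; averaging [walk_at_gain] over [j] therefore lowers any bound
   [c >= e] on the atoms of [S_n] by a factor which depends only on [e]. *)
Lemma two_atoms_concentration a b : a != b -> 0 < at_ 1 a -> 0 < at_ 1 b ->
  forall e, 0 < e -> exists n, forall y, at_ n y <= e.
Proof.
move=> ab a0 b0 e e0.
(* For [c >= e] the average of the [at_ n (y - z j)] over [m + 1] points is then at most
   [1 / (m + 1) <= c / 2]. *)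
have [m me] : exists m : nat, 2 <= m.+1%:R * e.
  exists (Num.truncn (2 / e)); rewrite -ler_pdivrMr// ltW//.
  by rewrite truncnS_gt.
(* The value of [S_m] after [j] steps [a] and [m - j] steps [b]; these points are distinct because
   [a != b]. *)
pose z j := j%:R * a + (m%:R - j%:R) * b.
have zI : injective z.
  move=> j k /eqP; rewrite -subr_eq0 /z.
  rewrite (_ : _ - _ = (j%:R - k%:R) * (a - b)); last by ring.
  by rewrite mulf_eq0 !subr_eq0 (negbTE ab) orbF eqr_nat => /eqP.
have z_gt0 (j : 'I_m.+1) : 0 < at_ m (z j).
  have jm : (j <= m)%N by rewrite -ltnS.
  rewrite -[X in at_ X _](subnKC jm) /z -natrB//.
  by apply: walk_atD_gt0; exact: walk_at_natmul.
pose i := [arg min_(i < ord0 : 'I_m.+1) at_ m (z i)]%O.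
pose t := at_ m (z i).
have t0 : 0 < t by exact: z_gt0.
have tz (j : 'I_m.+1) : t <= at_ m (z j).
  by rewrite /t /i; case: arg_minP => // k _ ->.
have t1 : t <= 1 by rewrite -lee_fin -atE probability_le1.
have step_down n c : e <= c -> (forall y, at_ n y <= c) ->
    forall y, at_ (m + n) y <= c * (1 - t / 2).
  move=> ec Hc y.
  have H : \sum_(j < m.+1) at_ (m + n) y <=
      \sum_(j < m.+1) (c - t * c + t * at_ n (y - z j)).
    apply: ler_sum => j _; apply: (le_trans (walk_at_gain _ _ (z j) Hc)).
    have := tz j; have := Hc (y - z j); nra.
  have S1 : \sum_(j < m.+1) at_ n (y - z j) <= 1.
    apply: (@sum_walk_at n m.+1 (fun j => y - z j)) => j k /addrI/oppr_inj; exact: zI.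
  have sc (x : R) : \sum_(j < m.+1) x = m.+1%:R * x.
    by rewrite sumr_const card_ord mulr_natl.
  rewrite big_split/= -mulr_sumr !sc in H.
  have m1 : 0 < m.+1%:R :> R by rewrite ltr0n.
  rewrite -(ler_pM2l m1); apply: (le_trans H).
  have : 2 <= m.+1%:R * c by rewrite (le_trans me)// ler_pM2l.
  nra.
(* The maximum with [e] keeps the bound in the range [c >= e] where [step_down] applies. *)
have iter r : exists n, forall y, at_ n y <= Num.max e ((1 - t / 2) ^+ r).
  elim: r => [|r [n IH]].
    exists 0%N => y; rewrite expr0 le_max -(lee_fin _ 1) -atE probability_le1//.
    by rewrite orbT.
  exists (m + n)%N => y.
  apply: (le_trans (step_down _ _ _ IH y)); first by rewrite le_max lexx.
  rewrite exprS; case: (leP e ((1 - t / 2) ^+ r)) => H.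
    by rewrite mulrC le_max lexx orbT.
  by rewrite le_max; apply/orP; left; rewrite ler_piMr ?(ltW e0)//; lra.
have : (1 - t / 2) ^+ r @[r --> \oo] --> (0 : R).
  by apply: cvg_expr; rewrite ger0_norm; lra.
move=> /cvgrPdist_le/(_ _ e0)[r _ /(_ r (leqnn r))].
rewrite /= sub0r normrN => H; have [n Hn] := iter r.
exists n => y; apply: (le_trans (Hn y)); rewrite ge_max lexx/=.
exact: le_trans (ler_norm _) H.
Qed.

(** The last step contributes only if it equals [a], so each step multiplies the bound by [at_ 1 a],
    which is below 1 by nondegeneracy. *)
Lemma one_atom_concentration a : (forall y, y != a -> at_ 1 y = 0) ->
  forall e, 0 < e -> exists n, forall y, at_ n y <= e.
Proof.
move=> a1 e e0.
have p1 : at_ 1 a < 1.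
  have := step_nondegenerate a; congr (fine (mu _) < 1).
  by apply/seteqP; split => w /=; rewrite walk1.
have Hn n y : at_ n y <= at_ 1 a ^+ n.
  elim: n y => [|n IH] y.
    by rewrite expr0 -(lee_fin _ 1) -atE probability_le1.
  rewrite -lee_fin -addn1 walk_atD.
  rewrite (eq_integral (fun w => (at_ 1 a)%:E * (\1_[set w | walk n w = y - a] w)%:E)%E).
    rewrite ge0_integralZl//; last 2 first.
    - exact/measurable_EFinP/measurable_indic.
    - by rewrite lee_fin.
    rewrite integral_indic// setIT.
    apply: (@le_trans _ _ ((at_ 1 a)%:E * mu [set w | walk n w = (y - a)%R])%E) => //.
    by rewrite (atE n) -EFinM lee_fin addn1 exprS ler_wpM2l.
  move=> w _; rewrite -EFinM indicE.
  case: (eqVneq (y - walk n w) a) => ywa.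
    by rewrite ywa mem_set ?mulr1//= -ywa subKr.
  rewrite a1// memNset ?mulr0// => /= H; move: ywa.
  by rewrite H subKr eqxx.
have : at_ 1 a ^+ r @[r --> \oo] --> (0 : R).
  by apply: cvg_expr; rewrite ger0_norm.
move=> /cvgrPdist_le/(_ _ e0)[r _ /(_ r (leqnn r))].
rewrite /= sub0r normrN => H; exists r => y; apply: (le_trans (Hn r y)).
exact: le_trans (ler_norm _) H.
Qed.

Lemma concentration y : at_ n y @[n --> \oo] --> (0 : R).
Proof.
have C e : 0 < e -> exists n, forall y, at_ n y <= e.
  have [[a [b [ab a0 b0]]]|no] := pselect
      (exists a b, [/\ a != b, 0 < at_ 1 a & 0 < at_ 1 b]).
    exact: (two_atoms_concentration ab a0 b0).
  have [[a a0]|no1] := pselect (exists a, 0 < at_ 1 a).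
    apply: (@one_atom_concentration a) => // z za; apply/eqP; rewrite eq_le at_ge0 andbT.
    by rewrite leNgt; apply/negP => z0; apply: no; exists z, a.
  (* Without any atom, every point qualifies as the exceptional one; 0 is chosen. *)
  apply: (@one_atom_concentration 0) => z za; apply/eqP; rewrite eq_le at_ge0 andbT.
  by rewrite leNgt; apply/negP => z0; apply: no1; exists z.
apply/cvgrPdist_le => e /C[N HN]; near=> n.
rewrite sub0r normrN ger0_norm//.
have Nn : (N <= n)%N by near: n; exact: nbhs_infty_ge.
by rewrite -(subnK Nn); exact: walk_at_mono.
Unshelve. all: by end_near. Qed.

Lemma negative_prob_cvg rho :
  fine (mu [set w | 0 < walk n w]) @[n --> \oo] --> rho ->
  fine (mu [set w | walk n w < 0]) @[n --> \oo] --> 1 - rho.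
Proof.
move=> Hrho; have -> : (fun n => fine (mu [set w | walk n w < 0])) =
    (fun n => 1 - fine (mu [set w | 0 < walk n w]) - at_ n 0).
  apply/funext => n.
  have mneg : measurable [set w : seqspace G | walk n w < 0]
    by apply: measurable_lt_set => //; exact: mwalk.
  have mpos : measurable [set w : seqspace G | 0 < walk n w]
    by apply: measurable_lt_set => //; exact: mwalk.
  pose B k := nth set0 [:: [set w : seqspace G | walk n w < 0]; [set w | 0 < walk n w];
    [set w | walk n w = 0]] k.
  have B3 k : B k.+3 = set0 by case: k.
  have := @prob_partition _ _ _ mu 3 setT B.
  rewrite probability_setT !big_ord_recr/= big_ord0 add0r => ->.
  - by rewrite /B/=; ring.
  - by case=> [|[|[|k]]]; rewrite ?B3//; exact: mat.
  - by move=> [|[|[|j]]] [|[|[|k]]] w; rewrite ?B3// /B/= => H1 H2;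
      exfalso; move: H1 H2; lra.
  - move=> w; split => // _; case: (ltgtP (walk n w) 0) => H.
    + by exists 0%N.
    + by exists 1%N.
    + by exists 2%N.
rewrite -[1 - rho]subr0; apply: cvgB; last exact: concentration.
by apply: cvgB => //; exact: cvg_cst.
Qed.

End concentration.

(** * The space of generations *)

Section generations.
Context (R : realType).

(* A mark, the offspring numbers, and the number of immigrants. *)
Definition generation : pointedType := (mark R * (nat -> nat) * nat)%type.

Definition rectangle (B : set (mark R)) (K : nat) (A : nat -> set nat)
    (D : set nat) : set generation :=
  [set v | [/\ B v.1.1, forall j, (j < K)%N -> A j (v.1.2 j) & D v.2]].

(** These are the one-generation events whose probability given the environment is prescribed by
    [bp_quenched], and they form a pi-system. *)
Definition rectangles : set_system generation :=
  [set C | exists B K A D, measurable B /\ C = rectangle B K A D].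

(** Padding with the full set lets finitely many rectangles share one number of constrained
    offspring variables. *)
Definition pad (K : nat) (A : nat -> set nat) (j : nat) : set nat :=
  if (j < K)%N then A j else setT.

Lemma rectangle_pad B K L A D : (K <= L)%N ->
  rectangle B K A D = rectangle B L (pad K A) D.
Proof.
move=> KL; apply/seteqP; split => v [vB vA vD]; split => // j jK.
  by rewrite /pad; case: ifP => // ?; exact: vA.
by have := vA j (leq_trans jK KL); rewrite /pad jK.
Qed.

Lemma rectangles_setT : rectangles setT.
Proof.
exists setT, 0%N, (fun=> setT), setT; split => //.
by apply/seteqP; split.
Qed.

Lemma rectangles_setI : setI_closed rectangles.
Proof.
move=> _ _ [B1 [K1 [A1 [D1 [mB1 ->]]]]] [B2 [K2 [A2 [D2 [mB2 ->]]]]].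
rewrite (rectangle_pad _ _ _ (leq_maxl K1 K2)) (rectangle_pad B2 _ _ (leq_maxr K1 K2)).
exists (B1 `&` B2), (maxn K1 K2), (fun j => pad K1 A1 j `&` pad K2 A2 j), (D1 `&` D2).
split; first exact: measurableI.
apply/seteqP; split => v; last first.
  by move=> [[? ?] vA [? ?]]; split; split => // j jK; have [] := vA j jK.
by move=> [[? vA1 ?] [? vA2 ?]]; split => // j jK; split; [exact: vA1|exact: vA2].
Qed.

Definition genspace := seqspace rectangles.

Lemma measurable_genspace_env n :
  measurable_fun [set: genspace] (fun w : genspace => (w n).1.1).
Proof.
apply: (@measurable_coord _ _ rectangles_setT _ _ measurable (fun v => v.1.1)).
  by rewrite sigma_algebra_id//; exact: sigma_algebra_measurable.
move=> B mB; exists B, 0%N, (fun=> setT), setT; split => //.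
by apply/seteqP; split => // v [].
Qed.

Lemma measurable_genspace_xi n j :
  measurable_fun [set: genspace] (fun w : genspace => (w n).1.2 j).
Proof.
apply: (@measurable_coord _ _ rectangles_setT _ _ measurable (fun v => v.1.2 j)).
  by rewrite sigma_algebra_id//; exact: sigma_algebra_measurable.
move=> B mB; exists setT, j.+1, (fun k => if k == j then B else setT), setT; split => //.
apply/seteqP; split => [v Bv|v [_ /(_ j (ltnSn j))]]; last by rewrite eqxx.
by split => // k _; case: eqP => // ->.
Qed.

Lemma measurable_genspace_eta n :
  measurable_fun [set: genspace] (fun w : genspace => (w n).2).
Proof.
apply: (@measurable_coord _ _ rectangles_setT _ _ measurable (fun v => v.2)).
  by rewrite sigma_algebra_id//; exact: sigma_algebra_measurable.
move=> B mB; exists setT, 0%N, (fun=> setT), B; split => //.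
by apply/seteqP; split => // v [].
Qed.

Definition logmean (m : mark R) : R := ln (fine (\int[m.1]_k (k%:R%:E : \bar R))).

Lemma measurable_mark_eval (f : mark R -> pprobability nat R) (A : set nat) :
  measurable_fun setT f -> measurable_fun setT (fun m => f m A).
Proof. by move=> mf; exact: (measurable_kernel (kprobability mf)). Qed.

Lemma measurable_logmean : measurable_fun [set: mark R] logmean.
Proof.
apply: (measurableT_comp (@measurable_ln R)).
apply: (measurableT_comp (fine_measurable measurableT)).
apply: (@measurable_fun_integral_kernel _ _ _ _ _
  (fun m : mark R => m.1) _ (fun k : nat => (k%:R : R)%:E)) => //=.
by move=> U mU; apply: measurable_mark_eval; exact: measurable_fst.
Qed.

Definition genstep (v : generation) : R := logmean v.1.1.

Lemma measurable_genstep n :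
  measurable_fun [set: genspace] (fun w : genspace => genstep (w n)).
Proof. exact: measurableT_comp measurable_logmean (measurable_genspace_env n). Qed.

Fixpoint genZ (n z : nat) (w : genspace) : nat :=
  if n is m.+1 then (\sum_(j < genZ m z w) (w m).1.2 j + (w m).2)%N else z.

Lemma measurable_genZ n z : measurable_fun setT (genZ n z).
Proof.
elim: n => [|n IH] /=; first exact: measurable_cst.
apply: measurable_addn; last exact: measurable_genspace_eta.
apply: (@measurable_diag _ _ _
  (fun m (w : genspace) => (\sum_(j < m) (w n).1.2 j)%N)) => // m.
apply: (@measurable_sumn _ _ (fun j (w : genspace) => (w n).1.2 j)) => j.
exact: measurable_genspace_xi.
Qed.

Lemma genZ_splice_le j k z w : (j <= k)%N -> genZ j z (splice k w) = genZ j z w.1.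
Proof. by elim: j => //= j IH jk; rewrite IH ?(ltnW jk)// splice_lt. Qed.

Lemma genZ_spliceD k m z w :
  genZ (k + m) z (splice k w) = genZ m (genZ k z w.1) w.2.
Proof.
elim: m => [|m IH]; first by rewrite addn0 genZ_splice_le.
by rewrite addnS /= IH spliceD.
Qed.

End generations.

(** * Laws of the environment and of the generation sequence *)

Section generation_law.
Context d (T : measurableType d) (R : realType) (P : probability T R) (X : bprei P).
Local Open Scope ereal_scope.

(** The marks alone are treated as a sequence first: splicing them upgrades [bp_env_iid] from events
    to products of functions, as needed to factor the quenched formula. *)
Definition environment (w : T) : seqspace (measurable : set_system (mark R)) :=
  fun n => bp_env X n w.

Lemma measurable_environment : measurable_fun setT environment.
Proof.
apply: measurable_to_seqspace => n B mB.
by have := measurable_funP (bp_env X n) measurableT B mB; rewrite setTI.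
Qed.

HB.instance Definition _ :=
  isMeasurableFun.Build _ _ _ _ environment measurable_environment.

Definition environment_law : probability _ R := distribution P environment.

Lemma environment_law_splice : splice_invariant environment_law.
Proof.
apply: (@iid_splice_invariant _ _ _ _ _ _ (fun A => P (bp_env X 0%N @^-1` A))).
- by move=> A B; exact: measurableI.
- exact: measurableT.
move=> N A mA; have [id ind] := bp_env_iid X.
transitivity (\prod_(n < N) P (bp_env X n @^-1` A n)); first exact: ind.
by apply: eq_bigr => n _; exact: id.
Qed.

Lemma environment_integral_prod N (f : nat -> mark R -> \bar R) :
  (forall n, measurable_fun setT (f n)) -> (forall n m, 0 <= f n m) ->
  \int[P]_w \prod_(n < N) f n (bp_env X n w) =
  \prod_(n < N) \int[P]_w f n (bp_env X 0%N w).
Proof.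
move=> mf f0.
have mc k : measurable_fun setT
    (fun e : seqspace (measurable : set_system (mark R)) => e k).
  apply: (@measurable_coord _ _ measurableT _ _ measurable id) => //.
  by rewrite sigma_algebra_id//; exact: sigma_algebra_measurable.
transitivity (\int[environment_law]_e \prod_(n < N) f n (e n)).
  rewrite ge0_integral_distribution//; last by move=> e; apply: prode_ge0.
  apply: (@emeasurable_prod _ (seqspace _) _ N (fun n e => f n (e n))) => n.
  exact: measurableT_comp.
rewrite (splice_integral_prod environment_law_splice)//; last first.
  by move=> m n; exact: measurableT_comp.
apply: eq_bigr => n _; rewrite ge0_integral_distribution//.
exact: measurableT_comp.
Qed.

End generation_law.

Section generation_sequence.
Context d (T : measurableType d) (R : realType) (P : probability T R) (X : bprei P).
Local Open Scope ereal_scope.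

(** Letter [n] holds everything that produces [Z_(n+1)] from [Z_n], hence the immigrants with index
    [n + 1]. *)
Definition generation_seq (w : T) : genspace R :=
  fun n => (bp_env X n w, (fun j => bp_xi X n j w), bp_eta X n.+1 w).

Lemma measurable_generation_seq : measurable_fun setT generation_seq.
Proof.
apply: measurable_to_seqspace => n _ [B [K [A [D [mB ->]]]]].
have mpre d' (U : measurableType d') (f : {mfun T >-> U}) C : measurable C ->
    measurable (f @^-1` C).
  by move=> mC; have := measurable_funP f measurableT C mC; rewrite setTI.
rewrite (_ : mkset _ = bp_env X n @^-1` B `&`
  ([set w | forall j, (j < K)%N -> (bp_xi X n j @^-1` A j) w] `&`
   bp_eta X n.+1 @^-1` D)); last first.
  by apply/seteqP; split => w [] // ? [] //.
apply: measurableI; first exact: mpre.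
apply: measurableI; last exact: mpre.
by apply: measurable_forall_lt => j; exact: mpre.
Qed.

HB.instance Definition _ :=
  isMeasurableFun.Build _ _ _ _ generation_seq measurable_generation_seq.

Definition generation_law : probability (genspace R) R := distribution P generation_seq.

(** The conditional probability of a rectangle given that the mark is [m]. *)
Let weight (B : set (mark R)) K (A : nat -> set nat) (D : set nat) (m : mark R) :
    \bar R :=
  (\1_B m)%:E * ((\prod_(j < K) m.1 (A j)) * m.2 D).

Let weight_ge0 B K A D m : 0 <= weight B K A D m.
Proof.
rewrite /weight mule_ge0 ?lee_fin// mule_ge0//.
by apply: prode_ge0 => j _; exact: measure_ge0.
Qed.

Let measurable_weight B K A D : measurable B -> measurable_fun setT (weight B K A D).
Proof.
move=> mB; apply: emeasurable_funM.
  exact/measurable_EFinP/measurable_indic.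
apply: emeasurable_funM; last by apply: measurable_mark_eval; exact: measurable_snd.
apply: (@emeasurable_prod _ (mark R) _ K (fun j (m : mark R) => m.1 (A j))) => j.
by apply: measurable_mark_eval; exact: measurable_fst.
Qed.

Let rectangle_prob N K (B : nat -> set (mark R)) (A : nat -> nat -> set nat)
    (D : nat -> set nat) : (forall n, measurable (B n)) ->
  generation_law (cylinder N (fun n => rectangle (B n) K (A n) (D n))) =
  \prod_(n < N) \int[P]_w weight (B n) K (A n) (D n) (bp_env X 0%N w).
Proof.
move=> mB; rewrite -(@environment_integral_prod _ _ _ _ X N
  (fun n => weight (B n) K (A n) (D n))); last 2 first.
- by move=> n; exact: measurable_weight.
- by move=> n m; exact: weight_ge0.
pose E := \bigcap_(n in [set n | (n < N)%N]) (bp_env X n @^-1` B n).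
have sE : env_sigma (bp_env X) E.
  apply: (@fin_bigcap_measurable _ (g_sigma_algebraType
    (\bigcup_n preimage_set_system [set: T] (bp_env X n) measurable))) => // n _.
  apply: sub_sigma_algebra; exists n => //; exists (B n) => //.
  by rewrite setTI.
transitivity (P (E `&` \bigcap_(n in [set n | (n < N)%N])
  ((\bigcap_(j in [set j | (j < K)%N]) (bp_xi X n j @^-1` A n j))
   `&` bp_eta X n.+1 @^-1` D n))).
  congr (P _); apply/seteqP; split => [w wC|w [wE wC] n nN].
    by split => n nN; have [] := wC n nN.
  by have [? ?] := wC n nN; split => //; exact: wE.
rewrite (bp_quenched N K A D sE) integral_mkcond; apply: eq_integral => w _.
rewrite patchE /weight; case: ifPn => wE.
  apply: eq_bigr => n _; rewrite indicE mem_set ?mul1e//.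
  by move/set_mem : wE; apply; exact: ltn_ord.
(* Off the environment event [E], one indicator factor vanishes and kills the whole product. *)
have [n nB] : exists n : 'I_N, ~ B n (bp_env X n w).
  apply: contrapT => H; move/negP: wE; apply; apply/mem_set => n nN.
  by apply: contrapT => nB; apply: H; exists (Ordinal nN).
by rewrite (bigD1 n)//= indicE memNset// !mul0e.
Qed.

Lemma generation_law_splice : splice_invariant generation_law.
Proof.
apply: (@iid_splice_invariant _ _ (@rectangles_setI R) (@rectangles_setT R) _ _
  (fun C => generation_law (cylinder 1 (fun=> C)))) => N C rC.
have /choice[F HF] : forall n,
    exists t : set (mark R) * nat * (nat -> set nat) * set nat,
      measurable t.1.1.1 /\ C n = rectangle t.1.1.1 t.1.1.2 t.1.2 t.2.
  move=> n; have [B [K [A [D [mB CE]]]]] := rC n.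
  by exists (B, K, A, D).
(* [bp_quenched] uses the same number of offspring variables in all generations, so every rectangle
   is padded to the largest one. *)
pose L := (\max_(n < N) (F n).1.1.2)%N.
have CE (n : 'I_N) : C n =
    rectangle (F n).1.1.1 L (pad (F n).1.1.2 (F n).1.2) (F n).2.
  have [_ ->] := HF n; apply: rectangle_pad.
  exact: (leq_bigmax (F := fun n : 'I_N => (F n).1.1.2) n).
transitivity (generation_law (cylinder N (fun n => rectangle (F n).1.1.1 L
    (pad (F n).1.1.2 (F n).1.2) (F n).2))).
  congr (generation_law _); apply/seteqP; split => w wC n nN.
    by rewrite -(CE (Ordinal nN)); exact: wC.
  by have := wC n nN; rewrite -(CE (Ordinal nN)).
rewrite rectangle_prob; last by move=> n; have [] := HF n.
apply: eq_bigr => n _; rewrite CE.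
rewrite (@rectangle_prob 1 L (fun=> (F n).1.1.1)
  (fun=> pad (F n).1.1.2 (F n).1.2) (fun=> (F n).2)).
  by rewrite big_ord1.
by move=> _; have [] := HF n.
Qed.

End generation_sequence.

(** * Decomposition at the first minimum *)

Section translation.
Context d (T : measurableType d) (R : realType) (P : probability T R) (X : bprei P).

Local Notation W := (generation_seq X).
Local Notation mu := (generation_law X).
Local Notation walk := (@walk _ (@rectangles R) R (@genstep R)).
Local Notation ladder := (@ladder _ (@rectangles R) R (@genstep R)).

Lemma walk_generation_seq n w : walk n (W w) = bp_S X n w.
Proof. by []. Qed.

Lemma genZ_generation_seq n z w : genZ n z (W w) = bp_Z X n (z, w).
Proof. by elim: n => //= n ->. Qed.

Definition stay n : set (genspace R) :=
  [set w | forall j, (j < n.+1)%N -> 0 <= walk j w].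

Lemma measurable_stay n : measurable (stay n).
Proof.
apply: (@measurable_forall_lt _ _ _ (fun j => [set w : genspace R | 0 <= walk j w])) => j.
by apply: measurable_le_set => //; apply: measurable_walk; exact: measurable_genstep.
Qed.

Lemma bp_L_ge n w c : (c <= bp_L X n w) <-> forall j, (j < n.+1)%N -> c <= bp_S X j w.
Proof.
split => [cL j jn|H].
  apply: (le_trans cL); exact: (bigmin_le_cond _ (j := Ordinal jn)).
by apply: le_bigmin => [|j _]; exact: H.
Qed.

Lemma bp_L_ge0 n w : (0 <= bp_L X n w) <-> stay n (W w).
Proof. exact: bp_L_ge. Qed.

(** As [bp_tau] selects the first minimiser, it equals [n] precisely when all earlier values are
    strictly larger. *)
Lemma bp_tauE n w : (bp_tau X n w = n) <-> ladder n (W w).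
Proof.
have LS j : (j <= n)%N -> bp_L X n w <= bp_S X j w.
  by move=> jn; exact: ((proj1 (@bp_L_ge n w _)) (lexx _) j jn).
(* The search is split into the times before [n] and the test at [n]; failure of both would yield
   [n + 1]. *)
rewrite /bp_tau -addn1 iotaD find_cat /= add0n size_iota.
split => [|lad].
  case: ifPn => [|/hasPn nohas].
    by rewrite has_find size_iota => /[swap] ->; rewrite ltnn.
  case: eqP => [Sn _|_ /eqP]; last by rewrite addn1 eqn_leq ltnn.
  move=> j jn; rewrite /= !walk_generation_seq lt_neqAle Sn LS ?andbT 1?ltnW//.
  by rewrite eq_sym; apply: nohas; rewrite mem_iota.
have Sn : bp_S X n w = bp_L X n w.
  apply/eqP; rewrite eq_le LS// andbT; apply/bp_L_ge => j; rewrite ltnS leq_eqVlt.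
  by move=> /orP[/eqP -> //|jn]; exact/ltW/lad.
rewrite ifF ?Sn ?eqxx ?addn0//; apply/negbTE/hasPn => j; rewrite mem_iota => /= jn.
by rewrite -Sn gt_eqF//; exact: lad.
Qed.

Lemma bp_dE n : bp_d X n = fine (mu (ladder n)).
Proof.
rewrite /bp_d; congr (fine (P _)).
by apply/seteqP; split => w /= /bp_tauE.
Qed.

Lemma dirac_product (i : nat) (E : set (nat * T)) :
  (\d_i \x P)%E E = P [set w | E (i, w)].
Proof.
rewrite /product_measure1 integral_dirac//= diracT mul1e; congr (P _).
by apply/seteqP; split => w; rewrite /xsection/= inE.
Qed.

Section functional.
Variables (g : nat -> R) (B : R).
Hypothesis gB : forall k, 0 <= g k <= B.

Let g_ge0 k : 0 <= g k. Proof. by have /andP[] := gB k. Qed.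

Lemma measurable_nat_comp d' (S : measurableType d') (Z : S -> nat) (A : set S) :
  measurable_fun setT Z -> measurable A ->
  measurable_fun setT (fun x => (g (Z x) * \1_A x)%:E).
Proof.
move=> mZ mA; apply/measurable_EFinP; apply: measurable_funM.
  exact: measurableT_comp (@measurable_nat_fun _ _ g) mZ.
exact: measurable_indic.
Qed.

(** This is [E_z[g(Z_m); L_m >= 0]] as a function of the starting state. Its bound [B] is what makes
    total variation convergence of the initial laws applicable. *)
Definition kern m z : \bar R :=
  (\int[mu]_b (g (genZ m z b) * \1_(stay m) b)%:E)%E.

Lemma kern_ge0 m z : (0 <= kern m z)%E.
Proof. by apply: integral_ge0 => b _; rewrite lee_fin mulr_ge0. Qed.

Lemma kern_le m z : (kern m z <= B%:E)%E.
Proof.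
rewrite -[leRHS]mule1 -(probability_setT mu) -integral_cst//.
apply: ge0_le_integral => //.
- by move=> b _; rewrite lee_fin mulr_ge0.
- by apply: measurable_nat_comp; [exact: measurable_genZ|exact: measurable_stay].
- move=> b _; rewrite lee_fin indicE; have /andP[g0 gb] := gB (genZ m z b).
  by case: (_ \in _); rewrite ?mulr1// mulr0 (le_trans g0).
Qed.

Lemma kernE m z : kern m z = (fine (kern m z))%:E.
Proof.
by rewrite fineK// ge0_fin_numE ?kern_ge0// (le_lt_trans (kern_le m z))// ltry.
Qed.

Lemma integral_patch_indic d' (S : measurableType d') (nu : {measure set S -> \bar R})
    (f : S -> R) (A : set S) :
  (\int[nu]_(x in A) (f x)%:E = \int[nu]_x (f x * \1_A x)%:E)%E.
Proof.
rewrite integral_mkcond; apply: eq_integral => x _; rewrite patchE indicE.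
by case: ifP; rewrite ?mulr1 ?mulr0.
Qed.

Lemma bp_E_kern (nu : probability nat R) m :
  bp_E P nu (fun x => g (bp_Z X m x)) [set x | 0 <= bp_L X m x.2] =
  (\int[nu]_z kern m z)%E.
Proof.
rewrite /bp_E integral_patch_indic.
have mL : measurable [set x : nat * T | 0 <= bp_L X m x.2].
  apply: measurable_le_set => //.
  exact: measurableT_comp (measurable_bp_L X m) measurable_snd.
transitivity (\int[(nu \x P)%E]_x
  (g (bp_Z X m x) * \1_[set x : nat * T | 0 <= bp_L X m x.2] x)%:E)%E; first by [].
rewrite fubini_tonelli1.
- apply: eq_integral => z _; rewrite /kern ge0_integral_distribution//.
  + apply: eq_integral => w _ /=; rewrite genZ_generation_seq; congr (_ * _)%:E.
    rewrite !indicE; congr ((nat_of_bool _)%:R).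
    by apply/idP/idP => /set_mem/bp_L_ge0 H; apply/mem_set.
  + by apply: measurable_nat_comp; [exact: measurable_genZ|exact: measurable_stay].
  + by move=> b; rewrite lee_fin mulr_ge0.
- by apply: measurable_nat_comp => //; exact: measurable_bp_Z.
- by move=> x; rewrite lee_fin mulr_ge0.
Qed.

Lemma bp_E_dirac i n :
  bp_E P \d_i (fun x => g (bp_Z X n x)) setT = (\int[mu]_w (g (genZ n i w))%:E)%E.
Proof.
rewrite /bp_E; transitivity (\int[(\d_i \x P)%E]_x (g (bp_Z X n x))%:E)%E; first by [].
have mg : measurable_fun setT (fun x : nat * T => (g (bp_Z X n x))%:E).
  apply/measurable_EFinP.
  exact: measurableT_comp (@measurable_nat_fun _ _ g) (measurable_bp_Z X n).
rewrite fubini_tonelli1//; last by move=> x; rewrite lee_fin.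
rewrite integral_dirac//= diracT mul1e /fubini_F ge0_integral_distribution//.
- by apply: eq_integral => w _ /=; rewrite genZ_generation_seq.
- apply/measurable_EFinP.
  exact: measurableT_comp (@measurable_nat_fun _ _ g) (measurable_genZ n i).
- by move=> w; rewrite lee_fin.
Qed.

(** The event [tau_n = k], with time 0 now among the candidates. *)
Definition argmin_at n k : set (genspace R) :=
  ladder k `&` [set w | forall j, (j < n.+1)%N -> (k <= j)%N -> walk k w <= walk j w].

Lemma measurable_argmin_at n k : measurable (argmin_at n k).
Proof.
have mw j : measurable_fun setT (walk j : genspace R -> R).
  by apply: measurable_walk; exact: measurable_genstep.
apply: measurableI.
  by apply: measurable_ladder; exact: measurable_genstep.
apply: (@measurable_forall_lt _ _ _
  (fun j => [set w : genspace R | (k <= j)%N -> walk k w <= walk j w])) => j.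
case: (leqP k j) => kj.
  rewrite (_ : mkset _ = [set w | walk k w <= walk j w]).
    exact: measurable_le_set.
  by apply/seteqP; split => [w /(_ isT)|w + _].
by rewrite (_ : mkset _ = setT)//; apply/seteqP; split.
Qed.

Lemma argmin_at_partition n w :
  \sum_(k < n.+1) \1_(argmin_at n k) w = 1 :> R.
Proof.
pose good m := [forall j : 'I_n.+1, walk m w <= walk j w].
have ex : exists m, (m <= n)%N && good m.
  pose i := [arg min_(i < ord0 : 'I_n.+1) walk i w]%O.
  exists i; rewrite -ltnS ltn_ord/=; apply/forallP => j.
  by rewrite /i; case: arg_minP => // k _ ->.
case: (ex_minnP ex) => m /andP[mn /forallP gm] mmin.
have gm' j : (j <= n)%N -> walk m w <= walk j w.
  by move=> jn; exact: (gm (Ordinal (jn : (j < n.+1)%N))).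
rewrite (bigD1 (Ordinal (mn : (m < n.+1)%N)))//= indicE mem_set; last first.
  split=> j jm; last by move=> _; exact: gm'.
  rewrite ltNge; apply/negP => jw.
  have : (m <= j)%N.
    apply: mmin; rewrite (ltnW (leq_trans jm mn))/=; apply/forallP => i.
    exact: le_trans jw (gm i).
  by rewrite leqNgt jm.
rewrite big1 ?addr0// => k km; rewrite indicE memNset// => -[k1 k2].
have {}km : (k : nat) != m by apply: contra km => /eqP km; apply/eqP/val_inj.
case: (ltngtP k m) => [lt|gt|eq]; last by rewrite eq eqxx in km.
- have := k2 m; rewrite ltnS mn => /(_ isT (ltnW lt)) wkm.
  have : (m <= k)%N.
    apply: mmin; rewrite -ltnS ltn_ord/=; apply/forallP => i.
    exact: le_trans wkm (gm i).
  by rewrite leqNgt lt.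
- by have := k1 m gt; rewrite ltNge gm'// -ltnS.
Qed.

Lemma argmin_at_splice n k a b : (k <= n)%N ->
  argmin_at n k (splice k (a, b)) <-> ladder k a /\ stay (n - k) b.
Proof.
move=> kn; split => [[lad st]|[lad st]]; split.
- by move=> j jk; have := lad j jk; rewrite !walk_splice_le// ltnW.
- move=> j; rewrite ltnS leq_subRL// => jk; have := st (k + j)%N.
  by rewrite ltnS jk leq_addr walk_spliceD walk_splice_le//= lerDl => /(_ isT isT).
- by move=> j jk; rewrite !walk_splice_le ?(ltnW jk)//; exact: lad.
- move=> j jn kj; rewrite -(subnKC kj) walk_spliceD walk_splice_le//= lerDl.
  by apply: st; rewrite ltnS leq_sub2r.
Qed.

(** Insert the partition by the first minimiser and splice at [k]: the indicator factors into
    [ladder k] for the prefix and [stay (n - k)] for the tail, on which the process restarts from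
    [Z_k]. *)
Lemma bp_E_decomposition i n :
  (\int[mu]_w (g (genZ n i w))%:E = \sum_(k < n.+1) \int[mu]_a
    ((\1_(ladder k) a)%:E * kern (n - k) (genZ k i a)))%E.
Proof.
transitivity (\int[mu]_w (\sum_(k < n.+1)
    (g (genZ n i w) * \1_(argmin_at n k) w)%:E))%E.
  apply: eq_integral => w _.
  by rewrite sumEFin -mulr_sumr argmin_at_partition mulr1.
have mf k : measurable_fun setT
    (fun w => (g (genZ n i w) * \1_(argmin_at n k) w)%:E).
  by apply: measurable_nat_comp; [exact: measurable_genZ|exact: measurable_argmin_at].
rewrite ge0_integral_sum//; last by move=> k w _; rewrite lee_fin mulr_ge0.
apply: eq_bigr => k _.
rewrite (splice_integral (generation_law_splice X) k)//; last first.
  by move=> w; rewrite lee_fin mulr_ge0.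
apply: eq_integral => a _; rewrite /kern -ge0_integralZl//; last 2 first.
- by apply: measurable_nat_comp; [exact: measurable_genZ|exact: measurable_stay].
- by move=> b _; rewrite lee_fin mulr_ge0.
have kn : (k <= n)%N by rewrite -ltnS.
apply: eq_integral => b _; rewrite -EFinM; congr (_%:E).
have -> : genZ n i (splice k (a, b)) = genZ (n - k) (genZ k i a) b.
  by have := genZ_spliceD k (n - k) i (a, b); rewrite subnKC.
rewrite [RHS]mulrCA; congr (_ * _).
rewrite !indicE -natrM mulnb; congr ((nat_of_bool _)%:R).
apply/idP/andP => [/set_mem/(argmin_at_splice _ _ kn)[la sb]|[/set_mem la /set_mem sb]].
  by split; exact: mem_set.
by apply/mem_set/argmin_at_splice.
Qed.

End functional.
End translation.

(** Slicing along the values of [Y] reduces a comparison with the entrance law to its point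
    masses. *)
Lemma integral_fiber d (S : measurableType d) (R : realType)
    (mu : {measure set S -> \bar R}) (Y : S -> nat) (L : set S) (H : nat -> \bar R) :
  measurable_fun setT Y -> measurable L -> (forall z, 0 <= H z)%E ->
  (\int[mu]_a ((\1_L a)%:E * H (Y a)) =
   \sum_(0 <= z <oo) H z * mu (Y @^-1` [set z] `&` L))%E.
Proof.
move=> mY mL H0.
have mpre z : measurable (Y @^-1` [set z]).
  by have := mY measurableT [set z] I; rewrite setTI.
have mI : measurable_fun setT (fun a => (\1_L a)%:E : \bar R).
  exact/measurable_EFinP/measurable_indic.
have mf : measurable_fun setT (fun a => ((\1_L a)%:E * H (Y a))%E).
  apply: emeasurable_funM => //.
  exact: measurableT_comp (@measurable_nat_fun _ _ H) mY.
have cover : \bigcup_z (Y @^-1` [set z]) = setT.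
  by apply/seteqP; split => // a _; exists (Y a).
rewrite -{1}cover ge0_integral_bigcup//; last 3 first.
- by rewrite cover.
- by move=> a _; rewrite mule_ge0// lee_fin.
- by move=> j k _ _ [a [/= <- <-]].
apply: eq_eseriesr => z _.
rewrite (eq_integral (fun a => H z * (\1_L a)%:E)%E); last first.
  by move=> a /[!inE] /= ->; rewrite muleC.
rewrite ge0_integralZl//; last by apply: measurable_funTS.
by rewrite integral_indic// setIC.
Qed.

(** * Entrance laws and the tail bound *)

Section entrance.
Context d (T : measurableType d) (R : realType) (P : probability T R) (X : bprei P).
Local Notation mu := (generation_law X).
Local Notation ladder := (@ladder _ (@rectangles R) R (@genstep R)).
Local Open Scope ereal_scope.

Lemma entrance_set1 i k z : bp_d X k != 0%R ->
  bp_entrance X i k [set z] =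
  ((bp_d X k)^-1)%:E * mu (genZ k i @^-1` [set z] `&` ladder k).
Proof.
move=> dk; have mladder : measurable (ladder k).
  by apply: measurable_ladder; exact: measurable_genstep.
have E (A : set (nat * T)) : bp_P P \d_i (A `&` bp_minE X k) =
    P ([set w | A (i, w)] `&` generation_seq X @^-1` ladder k).
  transitivity ((\d_i \x P) (A `&` bp_minE X k)); first by [].
  rewrite dirac_product; congr (P _).
  by apply/seteqP; split => w [Aw] /bp_tauE; split.
have dE : bp_P P \d_i (setT `&` bp_minE X k) = (bp_d X k)%:E.
  rewrite E (_ : mkset _ = setT); last by apply/seteqP; split.
  by rewrite setTI bp_dE fineK// fin_num_measure.
transitivity (cond_prob (bp_P P \d_i) (measurable_bp_minE X k)
  (bp_Z X k @^-1` [set z])); first by [].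
(* The normalising mass is [bp_d X k], finite and nonzero, so the default branch of [mnormalize] is
   avoided. *)
rewrite /cond_prob /= /mnormalize /= /mrestr dE eqe (negbTE dk)/=.
rewrite muleC E; congr (_ * P _).
by apply/seteqP; split => w [/= zw lw]; split => //; move: zw; rewrite /= genZ_generation_seq.
Qed.

(** The factor [bp_d X k] undoes the conditioning and leaves a restriction to [ladder k], the form
    produced by [bp_E_decomposition]. *)
Lemma integral_entrance i k (H : nat -> \bar R) : bp_d X k != 0%R ->
  (forall z, 0 <= H z) ->
  (bp_d X k)%:E * \int[bp_entrance X i k]_z H z =
  \int[mu]_a ((\1_(ladder k) a)%:E * H (genZ k i a)).
Proof.
move=> dk H0; have d0 : (0 <= bp_d X k)%R by rewrite bp_dE fine_ge0.
have mladder : measurable (ladder k).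
  by apply: measurable_ladder; exact: measurable_genstep.
rewrite integral_fiber//; last exact: measurable_genZ.
rewrite ge0_integral_nat// -nneseriesZl//; last by move=> z _; rewrite mule_ge0.
apply: eq_eseriesr => z _.
transitivity ((bp_d X k)%:E * (H z * bp_entrance X i k [set z])); first by [].
rewrite entrance_set1// muleCA; congr (_ * _).
by rewrite muleA -EFinM divff// mul1e.
Qed.

Lemma bp_E_tail_bound (g : nat -> R) (C s : R) (nu : probability nat R) m :
  (forall k, 0 <= g k)%R -> g 0%N = 0%R -> (0 <= C)%R ->
  (forall k, (1 <= k)%N -> g k <= C * k%:R `^ (- s))%R ->
  bp_E P nu (fun x => g (bp_Z X m x)) [set x | (0 <= bp_L X m x.2)%R] <=
  C%:E * bp_E P nu (fun x => ((bp_Z X m x)%:R `^ (- s))%R)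
    [set x | (0 < bp_Z X m x)%N /\ (0 <= bp_L X m x.2)%R].
Proof.
move=> g_ge0 g0 C0 gC; rewrite /bp_E.
rewrite integral_patch_indic [X in _ <= _ * X]integral_patch_indic.
have mZ := measurable_bp_Z X m.
have mL : measurable [set x : nat * T | (0 <= bp_L X m x.2)%R].
  apply: measurable_le_set => //.
  exact: measurableT_comp (measurable_bp_L X m) measurable_snd.
have mZL : measurable [set x : nat * T | (0 < bp_Z X m x)%N /\ (0 <= bp_L X m x.2)%R].
  apply: measurableI => //.
  by have := mZ measurableT [set z | (0 < z)%N] I; rewrite setTI.
have mf (h : nat -> R) (A : set (nat * T)) : measurable A ->
    measurable_fun setT (fun x => (h (bp_Z X m x) * \1_A x)%:E).
  by move=> mA; exact: measurable_nat_comp.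
rewrite -ge0_integralZl//; last first.
  exact: (mf (fun z => z%:R `^ (- s))%R).
apply: ge0_le_integral => //.
- by move=> x _; rewrite lee_fin mulr_ge0.
- exact: mf.
- by apply: measurable_funeM; exact: (mf (fun z => z%:R `^ (- s))%R).
move=> x _; rewrite -EFinM lee_fin !indicE.
(* Where [Z_m = 0] the left side vanishes because [g 0 = 0]; this is why the right side may be
   restricted to [Z_m > 0]. *)
have [->|Z0] := posnP (bp_Z X m x).
  by rewrite g0 mul0r mulr_ge0// mulr_ge0// powR_ge0.
rewrite mulrA; have -> :
    (x \in [set x : nat * T | (0 < bp_Z X m x)%N /\ (0 <= bp_L X m x.2)%R]) =
    (x \in [set x : nat * T | (0 <= bp_L X m x.2)%R]).
  by apply/idP/idP => /set_mem H; apply/mem_set; [case: H|split].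
by rewrite ler_wpM2r// gC.
Qed.

End entrance.

(** * The limit theorem, by feeding the ladder probabilities into the renewal results *)

Theorem corollary3p35 (R : realType) (d : measure_display) (T : measurableType d)
    (P : probability T R) (X : bprei P) (i : nat)
    (* (SD) *)
    (nondegenerate :
      ~ exists c : R, {ae P, forall w, bp_logmean X 0 w = c})
    (oscillating : {ae P, forall w,
      limn_esup (fun n => (bp_S X n w)%:E) = +oo%E /\
      limn_einf (fun n => (bp_S X n w)%:E) = -oo%E})
    (rho : R) (rho_gt0 : 0 < rho) (rho_lt1 : rho < 1)
    (spitzer : P [set w | 0 < bp_S X n w] @[n --> \oo] --> rho%:E)
    (* (EL) *)
    (nu : probability nat R)
    (entrance_cvg : tv_dist (bp_entrance X i k) nu @[k --> \oo] --> 0%E)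
    (entrance_pos : exists m0 : nat,
      (0 < bp_P P nu [set x | (0 < bp_Z X m0 x)%N /\ (0 <= bp_L X m0 x.2)%R])%E)
    (* (UIM) *)
    (s0 : R) (s0_gt0 : 0 < s0) (abar : R -> nat -> R)
    (abar_summable : forall s, 0 < s <= s0 ->
      summable [set: nat] (fun m => (abar s m)%:E))
    (abar_bound : forall s, 0 < s <= s0 -> forall m,
      (ereal_sup [set bp_E P mu (fun x => (bp_Z X m x)%:R `^ (- s))%R
                    [set x | (0 < bp_Z X m x)%N /\ (0 <= bp_L X m x.2)%R]
                  | mu in range (bp_entrance X i) `|` [set nu]]
       <= (abar s m)%:E)%E)
    (* (LOC) *)
    (abar_loc : forall s, 0 < s <= s0 ->
      (bp_d X n)^-1 * (\sum_(0 <= k < n./2.+1) bp_d X k * abar s (n - k)%N)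
        @[n --> \oo] --> 0)
    (g : nat -> R) (g_ge0 : forall k, 0 <= g k)
    (g_bounded : exists B : R, forall k, g k <= B)
    (g0 : g 0%N = 0)
    (q Cg : R) (q_gt0 : 0 < q)
    (g_decay : forall k, (1 <= k)%N -> g k <= Cg * k%:R `^ (- q)) :
  let limit := (\sum_(0 <= m <oo)
    bp_E P nu (fun x => g (bp_Z X m x)) [set x | (0 <= bp_L X m x.2)%R])%E in
  (bp_E P \d_i (fun x => g (bp_Z X n x)) [set: nat * T] * ((bp_d X n)^-1)%R%:E)%E
    @[n --> \oo] --> limit /\
  (0 <= limit < +oo)%E.
Proof.
move=> limit.
(* If a level set of the log-mean had probability 1, its complement would be a null set and the
   log-mean would be almost surely constant. *)
have step_nd c : fine (generation_law X [set w | genstep (w 0%N) = c]) < 1.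
  pose E := [set w | bp_logmean X 0 w = c].
  have mE : measurable E.
    have mlog : measurable_fun setT (bp_logmean X 0).
      apply: (measurableT_comp (@measurable_ln R)).
      apply: (measurableT_comp (fine_measurable measurableT)).
      exact: measurable_bp_mean.
    exact: measurable_eq_set.
  have -> : generation_law X [set w | genstep (w 0%N) = c] = P E by [].
  rewrite ltNge; apply/negP => PE; apply: nondegenerate; exists c.
  exists (~` E); split => //; first exact: measurableC.
  rewrite probability_setC//; apply/eqP; rewrite eq_le; apply/andP; split.
    by rewrite -(@fineK _ (P E)) ?fin_num_measure// -EFinB lee_fin subr_le0.
  by rewrite sube_ge0 ?probability_le1// fin_num_measure.
have mu_splice := generation_law_splice X.
have mstep := @measurable_genstep R.
pose mu := generation_law X.
pose neg n := fine (mu [set w | walk (@genstep R) n w < 0]).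
have neg_cvg : neg n @[n --> \oo] --> 1 - rho.
  apply: (negative_prob_cvg mu_splice mstep step_nd).
  exact: (@fine_cvg _ _ _ _ _ rho spitzer).
have d0 : bp_d X 0 = 1 by rewrite bp_dE; exact: ladder0.
have d_ge0 n : 0 <= bp_d X n by rewrite bp_dE fine_ge0.
have d_noninc n : bp_d X n.+1 <= bp_d X n.
  by rewrite !bp_dE; exact: ladder_noninc.
have neg_ge0 n : 0 <= neg n by rewrite /neg fine_ge0.
have neg_le1 n : neg n <= 1.
  rewrite /neg -lee_fin fineK ?probability_le1// ?fin_num_measure//.
    by apply: measurable_lt_set => //; exact: measurable_walk.
  by apply: measurable_lt_set => //; exact: measurable_walk.
have d_rec n : n%:R * bp_d X n = \sum_(1 <= k < n.+1) neg k * bp_d X (n - k)%N.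
  rewrite bp_dE (ladder_recursion mu_splice mstep).
  by apply: eq_bigr => k _; rewrite bp_dE.
have rho1 : 0 < 1 - rho by rewrite subr_gt0.
have d_gt0 := renewal_gt0 d0 d_ge0 d_noninc neg_ge0 d_rec neg_cvg rho1.
have d_dom := renewal_dominated d0 d_ge0 d_noninc neg_ge0 neg_le1 d_rec neg_cvg rho1.
have d_ratio := renewal_ratio_cvg d0 d_ge0 d_noninc neg_ge0 neg_le1 d_rec neg_cvg rho1.
have [B gB] := g_bounded.
have {}gB k : 0 <= g k <= B by rewrite g_ge0 gB.
(* Evaluate the decay bound at [k = 1], where the power equals 1. *)
have Cg0 : 0 <= Cg.
  by have := g_decay 1%N isT; rewrite powR1 mulr1; exact: le_trans.
(* Lowering the exponent to [s] weakens the bound on [g], since [k >= 1], and puts it in the range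
   of (UIM) and (LOC). *)
pose s := Num.min q s0.
have s_range : 0 < s <= s0 by rewrite lt_min q_gt0 s0_gt0 ge_min lexx orbT.
have gs k : (1 <= k)%N -> g k <= Cg * k%:R `^ (- s).
  move=> k1; apply: (le_trans (g_decay k k1)); rewrite ler_wpM2l//.
  by apply: ler_powR; rewrite ?ler1n// lerN2 ge_min lexx.
pose M m := Cg * abar s m.
pose A m := [set x : nat * T | 0 <= bp_L X m x.2].
pose e k m := fine (bp_E P (bp_entrance X i k) (fun x => g (bp_Z X m x)) (A m)).
pose e' m := fine (bp_E P nu (fun x => g (bp_Z X m x)) (A m)).
have bp_E_ge0 (m : probability nat R) n :
    (0 <= bp_E P m (fun x => g (bp_Z X n x)) (A n))%E.
  by apply: integral_ge0 => x _; rewrite lee_fin.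
have bp_E_le (m : probability nat R) n : (range (bp_entrance X i) `|` [set nu]) m ->
    (bp_E P m (fun x => g (bp_Z X n x)) (A n) <= (M n)%:E)%E.
  move=> hm; apply: le_trans (bp_E_tail_bound X m n g_ge0 g0 Cg0 gs) _.
  rewrite EFinM lee_wpmul2l// ?lee_fin//.
  by apply: (le_trans _ (abar_bound s s_range n)); apply: ereal_sup_ubound; exists m.
have bp_E_fin (m : probability nat R) n : (range (bp_entrance X i) `|` [set nu]) m ->
    (bp_E P m (fun x => g (bp_Z X n x)) (A n) =
     (fine (bp_E P m (fun x => g (bp_Z X n x)) (A n)))%:E)%E.
  move=> hm; rewrite fineK// ge0_fin_numE//.
  by rewrite (le_lt_trans (bp_E_le m n hm))// ltry.
have hent k : (range (bp_entrance X i) `|` [set nu]) (bp_entrance X i k).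
  by left; exists k.
have e_bound k m : 0 <= e k m <= M m.
  by rewrite fine_ge0//= -lee_fin -bp_E_fin// bp_E_le.
(* For fixed [m], both expectations integrate the same bounded function [kern X g m] of the starting
   state, so (EL) applies. *)
have e_cvg m : e k m @[k --> \oo] --> e' m.
  have kE (v : probability nat R) : bp_E P v (fun x => g (bp_Z X m x)) (A m) =
      (\int[v]_z (fine (kern X g m z))%:E)%E.
    rewrite (bp_E_kern X gB); apply: eq_integral => z _; exact: (kernE X gB).
  rewrite /e /e'; under eq_fun do rewrite kE.
  rewrite kE.
  apply: (@tv_integral_cvg _ _ _ _ B) => // k.
  by rewrite fine_ge0 ?(kern_ge0 X gB)//= -lee_fin -(kernE X gB) (kern_le X gB).
have M_summable : summable [set: nat] (EFin \o M).
  exact: (@summableZl _ Cg (abar s) Cg0 (abar_summable s s_range)).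
have M_loc : (bp_d X n)^-1 * (\sum_(0 <= k < n./2.+1) bp_d X k * M (n - k)%N)
    @[n --> \oo] --> 0.
  rewrite -[X in _ --> X](mulr0 Cg).
  rewrite (_ : (fun n => _) = (fun n => Cg * ((bp_d X n)^-1 *
      (\sum_(0 <= k < n./2.+1) bp_d X k * abar s (n - k)%N)))).
    by apply: cvgM; [exact: cvg_cst|exact: abar_loc].
  apply/funext => n; rewrite [RHS]mulrCA [in RHS]mulr_sumr; congr (_ * _).
  by apply: eq_bigr => k _; rewrite /M mulrCA.
have limitE : limit = (\sum_(0 <= m <oo) (e' m)%:E)%E.
  by apply: eq_eseriesr => m _; apply: bp_E_fin; right.
rewrite limitE; split; last exact: renewal_convolution_lty e_bound e_cvg M_summable.
have := renewal_convolution_cvg d_gt0 d_dom d_ratio e_bound e_cvg M_summable M_loc.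
apply: cvg_trans; apply: near_eq_cvg; apply: nearW => n.
(* The expectation under [P_i] is identified term by term with the renewal convolution of [bp_d X]
   and [e]. *)
rewrite (bp_E_dirac X gB) (bp_E_decomposition X gB) EFinM; congr (_ * _)%E.
rewrite -sumEFin big_mkord; apply: eq_bigr => k _.
rewrite EFinM -bp_E_fin// (bp_E_kern X gB) integral_entrance//.
  by rewrite gt_eqF.
by move=> z; exact: (kern_ge0 X gB).
Qed.
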